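(* For every field $\mathbb{F}$, the correlation constants satisfy $\frac{8}{7} \le \alpha_\mathbb{F} \le \alpha_{\mathrm{Mat}} \le 2$.
   Context: For a matroid $\mathrm{M}$ on a finite set $E$ and positive weights $w=(w_e)$, let $\mathrm{B}$ be a random basis with $\mathbb{P}(\mathrm{B}=b)\propto\prod_{e\in b}w_e$. An element is a loop if it lies in no basis and a coloop if it lies in every basis. Define \[ \alpha(\mathrm{M})=\sup \frac{\mathbb{P}(i \in \mathrm{B}, j \in \mathrm{B})\ \mathbb{P}(i \notin \mathrm{B}, j \notin \mathrm{B})}{\mathbb{P}(i \in \mathrm{B}, j \notin \mathrm{B})\ \mathbb{P}(i \notin \mathrm{B}, j \in \mathrm{B})}, \] the supremum over all distinct elements $i,j$ that are neither loops nor coloops and all positive weights $w$; if every element of $\mathrm{M}$ is a loop or a coloop, set $\alpha(\mathrm{M})=0$. The correlation constant $\alpha_\mathbb{F}$ of a field $\mathbb{F}$ is the supremum of $\alpha(\mathrm{M})$ over all matroids $\mathrm{M}$ representable over $\mathbb{F}$, and $\alpha_{\mathrm{Mat}}$ is the supremum of $\alpha(\mathrm{M})$ over all matroids. *)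

(* Defs.v *)
From HB Require Import structures.
From mathcomp Require Import all_boot all_order all_algebra.
From mathcomp Require Import boolp classical_sets reals ereal.

Set Implicit Arguments.
Unset Strict Implicit.
Unset Printing Implicit Defensive.

Import Order.TTheory GRing.Theory Num.Theory.

Local Open Scope ring_scope.

Record matroid (E : finType) := Matroid {
  bases : {set {set E}};
  bases_nonempty : exists b, b \in bases;
  bases_exchange : forall b1 b2 : {set E}, b1 \in bases -> b2 \in bases ->
    forall e, e \in b1 :\: b2 ->
    exists2 f, f \in b2 :\: b1 & f |: (b1 :\ e) \in bases
}.

Section Matroid.
Variables (E : finType) (M : matroid E).

Definition indep (s : {set E}) : bool := [exists b in bases M, s \subset b].

Definition loop (e : E) : bool := [forall b in bases M, e \notin b].

Definition coloop (e : E) : bool := [forall b in bases M, e \in b].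

(* [free] is applied to the family (v e)_{e in s}, so repeated vectors count
   as dependent: parallel elements are allowed in a representation. *)
Definition representable (F : fieldType) : Prop :=
  exists (n : nat) (v : E -> 'rV[F]_n),
    forall s : {set E}, indep s = free [seq v e | e <- enum s].

Variables (R : realType) (w : E -> R).

Definition weight (b : {set E}) : R := \prod_(e in b) w e.

Definition pmf (b : {set E}) : R :=
  if b \in bases M then weight b / \sum_(b' in bases M) weight b' else 0.

Definition prob (A : pred {set E}) : R := \sum_(b | A b) pmf b.

(* When i != j are neither loops nor coloops and w > 0, symmetric basis
   exchange makes both factors of the denominator positive, so the convention
   x / 0 = 0 never comes into play. *)
Definition correlation_ratio (i j : E) : R :=
  (prob (fun b => (i \in b) && (j \in b))
   * prob (fun b => (i \notin b) && (j \notin b)))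
  / (prob (fun b => (i \in b) && (j \notin b))
     * prob (fun b => (i \notin b) && (j \in b))).

End Matroid.

Definition alpha (R : realType) (E : finType) (M : matroid E) : \bar R :=
  if [forall e, loop M e || coloop M e] then 0%E
  else ereal_sup [set x : \bar R | exists (i j : E) (w : E -> R),
    [/\ i != j,
        ~~ loop M i /\ ~~ coloop M i,
        ~~ loop M j /\ ~~ coloop M j,
        forall e, 0 < w e
      & x = (correlation_ratio M w i j)%:E]]%classic.

Definition alpha_field (R : realType) (F : fieldType) : \bar R :=
  ereal_sup [set x : \bar R | exists (E : finType) (M : matroid E),
    representable M F /\ x = alpha R M]%classic.

Definition alpha_Mat (R : realType) : \bar R :=
  ereal_sup [set x : \bar R | exists (E : finType) (M : matroid E),
    x = alpha R M]%classic.

(* Main.v *)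
Require Import Defs.
From HB Require Import structures.
From mathcomp Require Import all_boot all_order all_algebra.
From mathcomp Require Import boolp classical_sets reals ereal.
From mathcomp Require Import ring lra zify.

Set Implicit Arguments.
Unset Strict Implicit.
Unset Printing Implicit Defensive.

Import Order.TTheory GRing.Theory Num.Theory.

Local Open Scope ring_scope.

(** Upper bound. Let [f] be the basis generating polynomial of a matroid of rank
    [d]. At every positive weight [w] the Hessian [H] of [f] is hyperbolic:
    [(x H x) (w H w) <= (x H w)^2]. This is proved by induction on the rank for
    all contractions at once. In rank two [H] is the square of a linear form
    minus a sum of squares indexed by parallel classes. In higher rank, summing
    the inequalities for the derivatives of [f] with Euler's relation gives
    [x H x <= sum_k w_k (H x)_k^2 / (H w)_k], which means that the nonnegative
    symmetric operator [diag(w / H w) H] has no eigenvalue strictly between 0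
    and 1; since [w] is its Perron eigenvector, for the simple eigenvalue 1, it
    is nonpositive on the orthogonal of [w]. For [x] supported on [{i, j}] and
    weights of [i] and [j] tending to 0 this gives
    [P(i, j) P(neither) <= 2 P(i only) P(j only)].

    Lower bound. In rank 5 take [j = e_0], [i = e_1 + e_2 + e_3 + e_4] and the
    points [e_k + t e_0] for [k = 1..4] and [t = 0..N-1], all with weight 1. Let
    [c] be the number of pairs of values of [t]. There are [4 c N^3] bases
    avoiding [i] and [j], [4 N^3] containing both, [N^4] containing only [j], and
    [tau + 12 c N^2] containing only [i], where [tau] counts the transversals of
    the four lines whose [t]-coordinates do not sum to 0. In characteristic [p],
    [N = p] gives [tau = p^4 - p^3] and a ratio of exactly 8/7; in characteristic
    0 the ratio tends to 8/7 as [N] grows. *)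

(** * Basis exchange *)

Section Exchange.
Variables (E : finType) (M : matroid E).

(** Induction on the size of [b1 :\: b2]: an exchange keeps the size of [b1] and removes one element
    from this difference. When the difference is empty, a proper inclusion of [b1] in [b2] would
    leave an element of [b2] with nothing to be exchanged for. *)
Lemma bases_card (b1 b2 : {set E}) :
  b1 \in bases M -> b2 \in bases M -> #|b1| = #|b2|.
Proof.
move: {2}#|b1 :\: b2|.+1 (ltnSn #|b1 :\: b2|) => n.
elim: n b1 => // n IHn b1 ltn hb1 hb2.
have [/eqP|[e he]] := set_0Vmem (b1 :\: b2).
  rewrite finset.setD_eq0 => sub12; apply/eqP; rewrite eqn_leq subset_leq_card //=.
  rewrite leqNgt; apply/negP => lt12.
  have /properP[_ [e e2 e1]]: b1 \proper b2 by rewrite properEcard sub12.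
  have [|f] := bases_exchange hb2 hb1 (e := e); first by rewrite inE e1.
  by rewrite inE => /andP[/negP nf /(fintype.subsetP sub12)].
have [f hf hb'] := bases_exchange hb1 hb2 he.
move: he hf; rewrite !inE => /andP[e2 e1] /andP[f1 f2].
rewrite -(IHn _ _ hb' hb2).
  by rewrite cardsU1 (cardsD1 e b1) e1 !inE (negPf f1) andbF.
have -> : (f |: b1 :\ e) :\: b2 = (b1 :\: b2) :\ e.
  by apply/setP => x; rewrite !inE; case: eqP => [->|_] /=; rewrite ?f2 ?andbF//= andbCA.
by move: ltn; rewrite (cardsD1 e (b1 :\: b2)) !inE e2 e1 /= !ltnS.
Qed.

(* Augmentation of [j |: s] by an element of [{i, k}]: exchange elements of a
   basis containing [j |: s] for elements of [b1] until it meets [{i, k}]. *)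
Lemma bases_augment (s : {set E}) (i j k : E) (b1 b2 : {set E}) :
  i != k -> i \notin s -> k \notin s -> b1 \in bases M -> b2 \in bases M ->
  s \subset b1 -> i \in b1 -> k \in b1 -> s \subset b2 -> j \in b2 ->
  exists2 b, b \in bases M & [&& s \subset b, j \in b & (i \in b) || (k \in b)].
Proof.
move=> nik nis nks hb1 + sb1 ib1 kb1.
move: {2}#|b2 :\: b1|.+1 (ltnSn #|b2 :\: b1|) => n.
elim: n b2 => // n IHn b2 ltn hb2 sb2 jb2.
have [ik2|] := boolP ((i \in b2) || (k \in b2)).
  by exists b2; rewrite ?sb2 ?jb2.
rewrite negb_or => /andP[ib2 kb2].
have [e0|[e he]] := set_0Vmem ((b2 :\: b1) :\ j).
  (* Here [b2 :\: b1] has at most the element [j] while [b1 :\: b2] contains both [i] and [k],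
     against the equality of cardinalities. *)
  have c1 : (#|b2 :\: b1| <= 1)%N by rewrite (cardsD1 j) e0 cards0 addn0 leq_b1.
  have : (#|[set i; k]| <= #|b1 :\: b2|)%N.
    apply/subset_leq_card/fintype.subsetP => x.
    by rewrite !inE => /orP[]/eqP->; rewrite ?ib1 ?kb1 ?ib2 ?kb2.
  have := bases_card hb1 hb2.
  rewrite cards2 nik -(cardsID b2 b1) -(cardsID b1 b2) finset.setIC => /addnI ->.
  by move=> /leq_trans/(_ c1).
move: he; rewrite !inE => /and3P[ej e1 e2].
have [|f] := bases_exchange hb2 hb1 (e := e); first by rewrite inE e1.
rewrite !inE => /andP[f2 f1] hb'.
apply: IHn hb' _ _.
- have -> : (f |: b2 :\ e) :\: b1 = (b2 :\: b1) :\ e.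
    by apply/setP => x; rewrite !inE; case: eqP => [->|_] /=; rewrite ?f1 ?andbF//= andbCA.
  by move: ltn; rewrite (cardsD1 e (b2 :\: b1)) !inE e2 e1 /= !ltnS.
- apply/fintype.subsetP => x xs; rewrite !inE (fintype.subsetP sb2)// andbT.
  by apply/orP; right; apply: contraNneq e1 => <-; exact: (fintype.subsetP sb1).
- by rewrite !inE jb2 [j == e]eq_sym ej orbT.
Qed.

End Exchange.

(** * Symmetric bilinear forms *)

Section LinearAlgebra.

(* The row space of a symmetric matrix is the orthogonal of its kernel. *)
Lemma symmetric_solve (T : finType) (K : fieldType) (L : T -> T -> K)
    (v g : T -> K) :
  (forall i j, L i j = L j i) ->
  (forall x : T -> K, (forall k, \sum_j x j * L j k = 0) ->
     exists c, forall j, x j = c * v j) ->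
  (forall k, \sum_j v j * L j k = 0) ->
  \sum_k g k * v k = 0 ->
  exists x : T -> K, forall k, \sum_j x j * L j k = g k.
Proof.
move=> Lsym Lker Lv gv.
have sumE (f : T -> K) : \sum_j f j = \sum_(a < #|T|) f (enum_val a).
  by rewrite (reindex (@enum_val T T)) //; apply: onW_bij; exact: enum_val_bij.
pose A := \matrix_(a < #|T|, b < #|T|) L (enum_val a) (enum_val b).
pose V := \row_(a < #|T|) v (enum_val a).
pose G := \row_(a < #|T|) g (enum_val a).
have AV : (A <= kermx V^T)%MS.
  apply/sub_kermxP/matrixP => a b; rewrite !mxE -[RHS](Lv (enum_val a)) sumE.
  by apply: eq_bigr => c _; rewrite !mxE mulrC Lsym.
have kerA : (kermx A <= V)%MS.
  apply/row_subP => a.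
  have := mulmx_ker A => /(congr1 (row a)); rewrite row_mul row0.
  set r := row a _ => rA.
  have [k|c hc] := Lker (fun j => r 0 (enum_rank j)).
    have := congr1 (fun X : 'rV_#|T| => X 0 (enum_rank k)) rA.
    rewrite mxE [RHS]mxE => rk; rewrite -[RHS]rk sumE; apply: eq_bigr => b _.
    by rewrite enum_valK [A _ _]mxE enum_rankK.
  apply/sub_rVP; exists c; apply/rowP => b.
  by have := hc (enum_val b); rewrite enum_valK !mxE.
have GA : (G <= A)%MS.
  apply: (@submx_trans _ _ _ _ _ _ (kermx V^T)).
    apply/sub_kermxP/matrixP => a b; rewrite !ord1 !mxE -[RHS]gv sumE.
    by apply: eq_bigr => c _; rewrite !mxE.
  (* The kernel of [A] lies in the line of [V], so [A] has at least the rank of [kermx V^T], and the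
     inclusion [AV] is an equality of row spaces. *)
  have := mxrank_leqif_sup AV; case => le <-.
  rewrite eqn_leq le mxrank_ker mxrank_tr /=.
  by have := mxrankS kerA; rewrite mxrank_ker !leq_subLR addnC.
have [X GX] := submxP GA.
exists (fun j => X 0 (enum_rank j)) => k.
have := congr1 (fun Y : 'rV_#|T| => Y 0 (enum_rank k)) GX.
rewrite !mxE enum_rankK => ->; rewrite sumE; apply: eq_bigr => a _.
by rewrite !mxE enum_valK enum_rankK.
Qed.

Variables (R : realFieldType) (T : finType).
Implicit Types (h : T -> T -> R) (x y z : T -> R).

Definition bform h x y : R := \sum_i \sum_j x i * y j * h i j.

Lemma bformC h x y : (forall i j, h i j = h j i) -> bform h x y = bform h y x.
Proof.
move=> hs; rewrite /bform exchange_big; apply: eq_bigr => i _.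
by apply: eq_bigr => j _; rewrite hs [x j * _]mulrC.
Qed.

Lemma bformBl h x y z (t : R) :
  bform h (fun i => x i - t * y i) z = bform h x z - t * bform h y z.
Proof.
rewrite /bform mulr_sumr -sumrB; apply: eq_bigr => i _.
by rewrite mulr_sumr -sumrB; apply: eq_bigr => j _; ring.
Qed.

Lemma bform_sub_sqr h x y (t : R) : (forall i j, h i j = h j i) ->
  bform h (fun i => x i - t * y i) (fun i => x i - t * y i) =
  bform h x x - 2 * t * bform h x y + t ^+ 2 * bform h y y.
Proof.
move=> hs; have -> : 2 * t * bform h x y = t * bform h x y + t * bform h y x.
  by rewrite (bformC y x hs); ring.
rewrite /bform opprD addrA !mulr_sumr -!sumrN -!big_split; apply: eq_bigr => i _ /=.
rewrite !mulr_sumr -!sumrN -!big_split; apply: eq_bigr => j _ /=; ring.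
Qed.

(** Completing the square: the right side minus the left is [(b - t c)^2 - c q], where [q] is the
    value of the form at [x - t y]. One nonpositive value on the line [x - t y] is therefore
    enough. *)
Lemma reverse_cauchy_schwarz h x y (t : R) : (forall i j, h i j = h j i) ->
  0 < bform h y y ->
  bform h (fun i => x i - t * y i) (fun i => x i - t * y i) <= 0 ->
  bform h x x * bform h y y <= bform h x y ^+ 2.
Proof.
move=> hs y0; rewrite bform_sub_sqr //.
set a := bform h x x; set b := bform h x y; set c := bform h y y => z0.
rewrite -subr_ge0 (_ : _ - _ =
  (b - t * c) ^+ 2 + c * - (a - 2 * t * b + t ^+ 2 * c)); last by ring.
by rewrite addr_ge0 ?sqr_ge0 // mulr_ge0 ?oppr_ge0 // ltW.
Qed.

End LinearAlgebra.

(** * The Hessian of the basis generating polynomial *)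

Section DerivativesOfBases.
Variables (R : realType) (E : finType) (M : matroid E) (w : E -> R).
Hypothesis w_gt0 : forall e, 0 < w e.

(* The iterated partial derivative of the basis generating polynomial along [s],
   at [w]; the polynomial is multiaffine, hence the value 0 when [s] has
   repetitions. *)
Definition dbasis (s : seq E) : R :=
  if uniq s then
    \sum_(b in bases M | all [in b] s) \prod_(e in b | e \notin s) w e
  else 0.

Lemma dbasis_perm s t : perm_eq s t -> dbasis s = dbasis t.
Proof.
move=> st; rewrite /dbasis (perm_uniq st); case: uniq => //.
apply: eq_big => [b|b _]; first by rewrite (perm_all _ st).
by apply: eq_bigl => e; rewrite (perm_mem st).
Qed.

Lemma dbasis_term_gt0 (s : seq E) (b : {set E}) :
  0 < \prod_(e in b | e \notin s) w e.
Proof. exact: prodr_gt0. Qed.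

Lemma dbasis_ge0 s : 0 <= dbasis s.
Proof.
rewrite /dbasis; case: uniq => //; apply: sumr_ge0 => b _.
exact/ltW/dbasis_term_gt0.
Qed.

Lemma dbasis_gt0P s :
  reflect (uniq s /\ exists2 b, b \in bases M & all [in b] s) (0 < dbasis s).
Proof.
apply: (iffP idP) => [|[us [b hb sb]]].
  rewrite /dbasis; case: uniq; last by rewrite ltxx.
  move=> lt; split=> //; apply: contrapT => nex; move: lt.
  by rewrite big1 ?ltxx // => b /andP[hb sb]; exfalso; apply: nex; exists b.
rewrite /dbasis us (bigD1 b) ?hb //=; apply: ltr_wpDr.
  by apply: sumr_ge0 => b' _; exact/ltW/dbasis_term_gt0.
exact: dbasis_term_gt0.
Qed.

Lemma dbasis_eq0 s : (dbasis s == 0) = ~~ (0 < dbasis s).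
Proof. by rewrite lt0r dbasis_ge0 andbT negbK. Qed.

Lemma dbasis_cons_gt0 k s : 0 < dbasis (k :: s) -> 0 < dbasis s.
Proof.
move/dbasis_gt0P => [/= /andP[_ us] [b hb /andP[_ sb]]].
by apply/dbasis_gt0P; split => //; exists b.
Qed.

Variable d : nat.
Hypothesis dE : forall b, b \in bases M -> #|b| = d.

(** Euler's relation for a homogeneous polynomial of degree [d - size s], by double counting: each
    basis containing [s] is reached once from every [k] it has outside [s]. *)
Lemma dbasis_euler s :
  \sum_k w k * dbasis (k :: s) = (d - size s)%:R * dbasis s.
Proof.
rewrite /dbasis /=; case us: (uniq s); last first.
  by rewrite mulr0 big1 // => k _; rewrite andbF mulr0.
under eq_bigr do rewrite andbT.
rewrite mulr_sumr (eq_bigr (fun k => \sum_(b in bases M | all [in b] s)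
    if (k \in b) && (k \notin s) then \prod_(e in b | e \notin s) w e else 0)).
  rewrite exchange_big; apply: eq_bigr => b /andP[hb sb].
  rewrite -big_mkcond sumr_const -[LHS]mulr_natl; congr (_%:R * _).
  have -> : #|[pred k in b | k \notin s]| = #|b :\: [set x in s]|.
    by apply: eq_card => k; rewrite !inE andbC.
  rewrite cardsD dE //; congr (_ - _)%N.
  rewrite -(card_uniqP us); apply: eq_card => k; rewrite !inE.
  by case ks: (k \in s); rewrite ?andbF // (allP sb _ ks).
move=> k _; case ks: (k \in s) => /=.
  by rewrite mulr0 big1 // => b _; rewrite andbF.
rewrite mulr_sumr [RHS]big_mkcondr [LHS]big_mkcondr; apply: eq_bigr => b hb /=.
case kb: (k \in b) => /=; last by case: all.
case: all => //; rewrite [RHS](bigD1 k) /= ?kb ?ks //; congr (_ * _).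
by apply: eq_bigl => e; rewrite inE negb_or -andbA [(_ != _) && _]andbC.
Qed.

(** The only basis that can contain [s] is then the set of its elements, and its monomial is an
    empty product. *)
Lemma dbasis_full s : size s = d -> dbasis s = (0 < dbasis s)%R%:R.
Proof.
move=> sd; case: dbasis_gt0P => [[us [b hb sb]]|/dbasis_gt0P]; last first.
  by move/negbTE/negbT; rewrite -dbasis_eq0 => /eqP.
have eqb b' : b' \in bases M -> all [in b'] s -> b' = [set x in s].
  move=> hb' sb'; apply/esym/eqP; rewrite eqEcard dE // -sd.
  rewrite (_ : #|[set x in s]| = size s) ?leqnn ?andbT; last first.
    by rewrite cardsE; exact/card_uniqP.
  by apply/fintype.subsetP => x; rewrite inE => /(allP sb').
rewrite /dbasis us (bigD1 b) ?hb //= [X in _ + X]big1 ?addr0 => [|b'].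
  by apply: big1 => e /andP[]; rewrite (eqb b) // inE => ->.
by case/andP => /andP[hb' sb']; rewrite (eqb b) // (eqb b') // eqxx.
Qed.

Lemma dbasis_swap i j s : dbasis [:: i, j & s] = dbasis [:: j, i & s].
Proof. by apply: dbasis_perm; apply/permP => a /=; rewrite addnCA. Qed.

Lemma dbasis_rot3 i j k s : dbasis [:: i, j, k & s] = dbasis [:: k, i, j & s].
Proof.
apply: dbasis_perm; apply/permP => a /=.
by rewrite [RHS]addnCA; congr (_ + _)%N; rewrite addnCA.
Qed.

(* In the contraction by [s], parallelism of non-loops is transitive. *)
Lemma dbasis_augment i j k s :
  0 < dbasis [:: i, k & s] -> 0 < dbasis (j :: s) ->
  0 < dbasis [:: i, j & s] \/ 0 < dbasis [:: j, k & s].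
Proof.
move=> ik js.
have [->|nji] := eqVneq j i; first by right.
have [->|njk] := eqVneq j k; first by left.
move/dbasis_gt0P: ik => [/=]; rewrite inE negb_or => /andP[/andP[nik nis] /andP[nks us]].
move=> [b1 hb1 /and3P[ib1 kb1 sb1]].
move/dbasis_gt0P: js => [/= /andP[njs _] [b2 hb2 /andP[jb2 sb2]]].
have subE (b : {set E}) : all [in b] s = ([set x in s] \subset b).
  apply/allP/fintype.subsetP => h x; first by rewrite inE; exact: h.
  by move=> xs; apply: h; rewrite inE.
rewrite subE in sb1; rewrite subE in sb2.
have [|||b hb /and3P[]] := bases_augment (s := [set x in s]) (j := j)
  nik _ _ hb1 hb2 sb1 ib1 kb1 sb2 _.
- by rewrite inE.
- by rewrite inE.
- by [].
rewrite -subE => sb jb /orP[ib|kb]; [left|right]; apply/dbasis_gt0P;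
  (split; last by exists b => //=; rewrite ?ib ?kb jb).
- by rewrite /= inE negb_or eq_sym nji nis njs us.
- by rewrite /= inE negb_or njk njs nks us.
Qed.

End DerivativesOfBases.

(** * From local to global hyperbolicity *)

Section LocalToGlobal.
Variables (R : realFieldType) (T : finType) (h : T -> T -> R) (w : T -> R).
Hypothesis h_sym : forall i j, h i j = h j i.
Hypothesis h_ge0 : forall i j, 0 <= h i j.
Hypothesis w_gt0 : forall i, 0 < w i.

Let u i := \sum_j h i j * w j.

Hypothesis h_connected : forall i j, u i != 0 -> u j != 0 ->
  h i j != 0 \/ exists2 k, h i k != 0 & h k j != 0.

(* If [u k = 0] then the [k]-th row of [h] vanishes, so the value [w k / 0 = 0]
   is the right one. *)
Hypothesis h_local : forall x : T -> R,
  bform h x x <= \sum_k w k / u k * (\sum_j x j * h j k) ^+ 2.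

(** [D] is the diagonal of [u / w], set to 1 on the zero rows of [h] to stay invertible. [L = D - h]
    is a weighted graph Laplacian, and [v], which is [w] cut to the nonzero rows, spans its
    kernel. *)
Let D i := if u i == 0 then 1 else u i / w i.
Let L i j := (i == j)%:R * D i - h i j.
Let v i := if u i == 0 then 0 else w i.

Let w_neq0 i : w i != 0. Proof. by rewrite gt_eqF. Qed.

Let u_ge0 i : 0 <= u i.
Proof. by apply: sumr_ge0 => j _; rewrite mulr_ge0 // ltW. Qed.

Let D_gt0 i : 0 < D i.
Proof.
rewrite /D; case: eqP => // /eqP u0; rewrite divr_gt0 // lt0r u0; exact: u_ge0.
Qed.

Let row0 i j : u i = 0 -> h i j = 0.
Proof.
move=> u0; have := psumr_eq0P (fun j _ => mulr_ge0 (h_ge0 i j) (ltW (w_gt0 j))) u0.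
by move/(_ j isT)/eqP; rewrite mulf_eq0 (negPf (w_neq0 j)) orbF => /eqP.
Qed.

Let L_sym i j : L i j = L j i.
Proof. by rewrite /L h_sym eq_sym; case: eqP => [->//|_]; rewrite !mul0r. Qed.

Let mulL x k : \sum_j x j * L j k = D k * x k - \sum_j x j * h j k.
Proof.
rewrite -sumrN (bigD1 k) //= [X in _ = _ + X](bigD1 k) //= addrA; congr (_ + _).
  by rewrite /L eqxx mul1r; ring.
by apply: eq_bigr => j /negPf jk; rewrite /L jk mul0r; ring.
Qed.

Let bformL x y : bform L x y = \sum_k D k * x k * y k - bform h x y.
Proof.
have E (g : T -> T -> R) : bform g x y = \sum_k y k * \sum_j x j * g j k.
  rewrite /bform exchange_big; apply: eq_bigr => k _; rewrite mulr_sumr.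
  by apply: eq_bigr => j _; ring.
rewrite !E -sumrB; apply: eq_bigr => k _; rewrite mulL; ring.
Qed.

(** In the coordinates [x i / w i] this is the Dirichlet form of the graph with edge weights
    [h i j * w i * w j]. It makes [L] positive semidefinite and exposes its kernel. *)
Let bformL_sqr x : bform L x x = \sum_(i | u i == 0) x i ^+ 2 +
  (\sum_i \sum_j h i j * w i * w j * (x i / w i - x j / w j) ^+ 2) / 2.
Proof.
have half : \sum_i \sum_j h i j * w j * (x i ^+ 2 / w i) =
            \sum_i u i * (x i ^+ 2 / w i).
  by apply: eq_bigr => i _; rewrite mulr_suml.
have half' : \sum_i \sum_j h i j * w i * (x j ^+ 2 / w j) =
            \sum_i u i * (x i ^+ 2 / w i).
  rewrite -half exchange_big; apply: eq_bigr => i _; apply: eq_bigr => j _.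
  by rewrite h_sym.
have -> : \sum_i \sum_j h i j * w i * w j * (x i / w i - x j / w j) ^+ 2 =
   2 * (\sum_i u i * (x i ^+ 2 / w i) - bform h x x).
  rewrite (_ : 2 * _ = \sum_i u i * (x i ^+ 2 / w i) +
    \sum_i u i * (x i ^+ 2 / w i) - 2 * bform h x x); last by ring.
  rewrite -{1}half -half' /bform mulr_sumr -big_split -sumrB; apply: eq_bigr => i _.
  rewrite mulr_sumr -big_split -sumrB; apply: eq_bigr => j _ /=.
  have := w_neq0 i; have := w_neq0 j => wj wi.
  by field; rewrite wi wj.
rewrite bformL (mulrC 2) mulfK ?pnatr_eq0 // addrA; congr (_ - _).
rewrite [X in _ = X + _]big_mkcond -big_split; apply: eq_bigr => i _ /=.
rewrite /D; case: eqP => [->|_]; first by ring.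
by rewrite add0r; field.
Qed.

Let bformL_ge0 x : 0 <= bform L x x.
Proof.
rewrite bformL_sqr addr_ge0 ?sumr_ge0 // => [i _|]; first exact: sqr_ge0.
rewrite divr_ge0 // sumr_ge0 // => i _; rewrite sumr_ge0 // => j _.
by rewrite mulr_ge0 ?sqr_ge0 // !mulr_ge0 // ltW.
Qed.

(** All the squares vanish, so [x] is 0 on the zero rows and [x / w] is constant along edges;
    [h_connected] joins any two nonzero rows by at most two edges. *)
Let L_ker x : (forall k, \sum_j x j * L j k = 0) -> exists c, forall j, x j = c * v j.
Proof.
move=> xL.
have /eqP : bform L x x = 0.
  rewrite /bform exchange_big; apply: big1 => k _; rewrite -[RHS](mulr0 (x k)).
  by rewrite -[in RHS](xL k) mulr_sumr; apply: eq_bigr => j _; ring.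
have sge0 i : 0 <= \sum_j h i j * w i * w j * (x i / w i - x j / w j) ^+ 2.
  by rewrite sumr_ge0 // => j _; rewrite mulr_ge0 ?sqr_ge0 // !mulr_ge0 // ltW.
rewrite bformL_sqr paddr_eq0; first last.
- by rewrite divr_ge0 // sumr_ge0.
- by rewrite sumr_ge0 // => i _; exact: sqr_ge0.
rewrite mulf_eq0 invr_eq0 pnatr_eq0 orbF => /andP[/eqP x0 /eqP xh].
have {}x0 i : u i = 0 -> x i = 0.
  move=> /eqP ui; have := psumr_eq0P (fun i _ => sqr_ge0 (x i)) x0 ui.
  by move/eqP; rewrite sqrf_eq0 => /eqP.
have {}xh i j : h i j != 0 -> x i / w i = x j / w j.
  move=> hij; have /(_ i isT) := psumr_eq0P (fun i _ => sge0 i) xh.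
  move/psumr_eq0P => /(_ _ j isT)/eqP.
  rewrite !mulf_eq0 (negPf hij) !(negPf (w_neq0 _)) /= orbb subr_eq0 => xx; apply/eqP/xx.
  by move=> k _; rewrite mulr_ge0 ?sqr_ge0 // !mulr_ge0 // ltW.
case: (pickP (fun i => u i != 0)) => [i ui|nu]; last first.
  exists 0 => j; rewrite mul0r x0 //; apply/eqP; exact: negbFE (nu j).
exists (x i / w i) => j; rewrite /v; case: eqP => [/x0 ->|/eqP uj]; first by rewrite mulr0.
rewrite (_ : x i / w i = x j / w j) ?divfK //.
have [/xh//|[k /xh -> /xh]//] := h_connected ui uj.
Qed.

Let Lv k : \sum_j v j * L j k = 0.
Proof.
rewrite mulL (_ : \sum_j _ = u k); last first.
  apply: eq_bigr => j _; rewrite /v; case: eqP => [/row0 h0|_]; last by rewrite mulrC h_sym.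
  by rewrite mul0r h_sym h0 mul0r.
rewrite /D /v; case: eqP => [->|_]; first by rewrite mulr0 subrr.
by rewrite divfK // subrr.
Qed.

(* For [y] orthogonal to [w] solve [L x = D y]. Then [h_local] says
   [y . D y >= x . D y], and positivity of [L] at [y - x] gives
   [y . L y >= 2 y . D y - x . D y >= y . D y], i.e. [y . h y <= 0]. *)
Lemma orthogonal_bform_le0 y : bform h y w = 0 -> bform h y y <= 0.
Proof.
move=> yw.
have yu : \sum_k u k * y k = 0.
  rewrite -[RHS]yw /bform; apply: eq_bigr => i _; rewrite mulr_suml.
  by apply: eq_bigr => j _; ring.
(* Solvability requires [D y] to be orthogonal to [v], which is the orthogonality of [y] and [w] for
   [h], since [D v = u]. *)
have [|x hx] := symmetric_solve (g := fun k => D k * y k) L_sym L_ker Lv.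
  rewrite -[RHS]yu; apply: eq_bigr => k _; rewrite /D /v.
  by case: eqP => [->|_]; [ring|field].
have loc := h_local x.
pose z k := \sum_j x j * h j k.
have xE k : D k * x k - z k = D k * y k by rewrite -mulL.
have zE : bform h x x = \sum_k x k * z k.
  rewrite /bform exchange_big; apply: eq_bigr => k _; rewrite mulr_sumr.
  by apply: eq_bigr => j _; ring.
(* Since [z = D (x - y)], [h_local] reads [x . D (x - y) <= (x - y) . D (x - y)]; on the zero rows
   [z] vanishes. *)
have le1 : \sum_k D k * x k * y k <= \sum_k D k * y k * y k.
  rewrite -subr_ge0 -sumrB; move: loc; rewrite zE -subr_ge0 -sumrB.
  congr (0 <= _); apply: eq_bigr => k _.
  have -> : y k = x k - z k / D k.
    by apply: (mulfI (lt0r_neq0 (D_gt0 k))); rewrite -xE; field; exact: lt0r_neq0.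
  have -> : (\sum_j x j * h j k) = z k by [].
  rewrite /D; case: eqP => [u0|/eqP u0]; last by field; rewrite u0 w_neq0.
  rewrite (_ : z k = 0); first by ring.
  by apply: big1 => j _; rewrite h_sym row0 // mulr0.
have := bformL_ge0 (fun i => y i - 1 * x i); rewrite bform_sub_sqr //.
rewrite (bformL y y) (bformL x x).
have -> : bform L y x = \sum_k D k * y k * y k.
  rewrite bformC // /bform exchange_big; apply: eq_bigr => k _.
  rewrite -hx mulr_suml; apply: eq_bigr => j _; exact: mulrAC.
have -> : \sum_k D k * x k * x k - bform h x x = \sum_k D k * x k * y k.
  rewrite zE -sumrB; apply: eq_bigr => k _.
  have -> : D k * x k * y k = x k * (D k * y k) by ring.
  by rewrite -xE; ring.
lra.
Qed.

End LocalToGlobal.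

(** * Hyperbolicity of the Hessian, by induction on the rank *)

Section Lorentzian.
Variables (R : realType) (E : finType) (M : matroid E) (w : E -> R).
Hypothesis w_gt0 : forall e, 0 < w e.
Variable d : nat.
Hypothesis dE : forall b, b \in bases M -> #|b| = d.

Local Notation db := (dbasis M w).
Local Notation hess s := (fun i j => db [:: i, j & s]).

Let hess_sym s i j : hess s i j = hess s j i.
Proof. exact: dbasis_swap. Qed.

Lemma hess_mulw s i : \sum_j hess s i j * w j = (d - (size s).+1)%:R * db (i :: s).
Proof.
rewrite -[in RHS]/(size (i :: s)) -(dbasis_euler w dE); apply: eq_bigr => j _.
by rewrite mulrC dbasis_swap.
Qed.

Lemma hess_bform_w s x :
  bform (hess s) x w = (d - (size s).+1)%:R * \sum_i x i * db (i :: s).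
Proof.
rewrite /bform mulr_sumr; apply: eq_bigr => i _.
rewrite mulrCA -hess_mulw mulr_sumr; apply: eq_bigr => j _; ring.
Qed.

Lemma hess_bform_ww s :
  bform (hess s) w w = (d - (size s).+1)%:R * ((d - size s)%:R * db s).
Proof. by rewrite hess_bform_w (dbasis_euler w dE). Qed.

(* In rank two the form is [(sum_i x_i)^2 - sum_C (sum_(i in C) x_i)^2], with
   [C] ranging over the parallel classes of non-loops. *)
Lemma hess_hyperbolic_rank2 s x : (size s).+2 = d ->
  bform (hess s) x x * bform (hess s) w w <= bform (hess s) x w ^+ 2.
Proof.
move=> sd.
have ww_ge0 : 0 <= bform (hess s) w w.
  by rewrite hess_bform_ww !mulr_ge0 ?ler0n // dbasis_ge0.
have [ww0|ww0] := eqVneq (bform (hess s) w w) 0.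
  by rewrite ww0 mulr0 sqr_ge0.
have ww_gt0 : 0 < bform (hess s) w w by rewrite lt0r ww0.
pose nl i := 0 < db (i :: s).
pose par i j := [&& nl i, nl j & db [:: i, j & s] == 0].
have par_refl i : nl i -> par i i.
  by move=> ni; rewrite /par ni /dbasis /= inE eqxx /= eqxx.
have par_sym i j : par i j = par j i.
  by rewrite /par dbasis_swap; case: (nl i); case: (nl j).
have par_trans i j k : par i j -> par j k -> par i k.
  move=> /and3P[ni nj ij] /and3P[_ nk jk]; rewrite /par ni nk /=.
  rewrite dbasis_eq0 //; apply/negP => /(dbasis_augment w_gt0)/(_ nj).
  by case=> /lt0r_neq0; rewrite ?ij ?jk.
(* A chosen representative of the parallel class of [i]; the default is reached only by loops, as
   [par] is reflexive on the others. *)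
pose canon i := odflt i [pick j | par i j].
have canonP i j : nl i -> nl j -> (canon i == canon j) = par i j.
  move=> ni nj; apply/eqP/idP => [|pij].
    rewrite /canon; case: pickP => [a ia|/(_ i)]; last by rewrite par_refl.
    case: pickP => [b jb|/(_ j)]; last by rewrite par_refl.
    move=> /= ab; apply: par_trans ia _; rewrite ab par_sym; exact: jb.
  have eqp : par i =1 par j.
    move=> k; apply/idP/idP; last exact: par_trans.
    by apply: par_trans; rewrite par_sym.
  rewrite /canon (eq_pick eqp); by case: pickP => // /(_ j); rewrite par_refl.
pose l (y : E -> R) := \sum_(i | nl i) y i.
pose p c (y : E -> R) := \sum_(i | nl i && (canon i == c)) y i.
have hE i j : hess s i j =
    (nl i)%:R * (nl j)%:R - \sum_c (nl i && (canon i == c))%:R * (nl j && (canon j == c))%:R.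
  have -> : \sum_c (nl i && (canon i == c))%:R * (nl j && (canon j == c))%:R =
     (par i j)%:R :> R.
    rewrite (bigD1 (canon i)) //= eqxx andbT big1 ?addr0; last first.
      by move=> c /negPf ic; rewrite [canon i == c]eq_sym ic andbF mul0r.
    case ni: (nl i); last by rewrite /par ni mul0r.
    case nj: (nl j); last by rewrite /par nj andbF mulr0.
    by rewrite eq_sym canonP // mul1r.
  rewrite /= (dbasis_full w_gt0 dE) // /par.
  case ij: (0 < _); last first.
    have -> : db [:: i, j & s] == 0 by rewrite dbasis_eq0 // ij.
    by case: (nl i); case: (nl j); rewrite /= ?(mul0r, mulr0, mulr1, subrr).
  have nj : nl j := dbasis_cons_gt0 w_gt0 ij.
  have ni : nl i by apply: (@dbasis_cons_gt0 _ _ _ w _ j); rewrite // dbasis_swap.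
  by rewrite ni nj (gt_eqF ij) mulr1 subr0.
have indE (P : pred E) (y : E -> R) : \sum_(i | P i) y i = \sum_i y i * (P i)%:R.
  by rewrite big_mkcond; apply: eq_bigr => i _; case: (P i); rewrite ?(mulr0, mulr1).
have lE y : l y = \sum_i y i * (nl i)%:R by exact: indE.
have pE c y : p c y = \sum_i y i * (nl i && (canon i == c))%:R by exact: indE.
have qE y : bform (hess s) y y = l y ^+ 2 - \sum_c p c y ^+ 2.
  rewrite /bform (eq_bigr (fun i => \sum_j (y i * (nl i)%:R * (y j * (nl j)%:R)) -
    \sum_j \sum_c (y i * (nl i && (canon i == c))%:R) *
       (y j * (nl j && (canon j == c))%:R))); last first.
    move=> i _; rewrite -sumrB; apply: eq_bigr => j _.
    rewrite hE mulrBr mulr_sumr; congr (_ - _); first by ring.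
    by apply: eq_bigr => c _; ring.
  rewrite sumrB; congr (_ - _).
    rewrite expr2 lE mulr_suml; by apply: eq_bigr => i _; rewrite mulr_sumr.
  under eq_bigr do rewrite exchange_big.
  rewrite exchange_big; apply: eq_bigr => c _; rewrite expr2 pE mulr_suml.
  by apply: eq_bigr => i _; rewrite mulr_sumr.
have lw : l w != 0.
  apply: contraTneq ww_gt0 => lw0; rewrite qE lw0 expr0n /= sub0r oppr_gt0 -leNgt.
  by apply: sumr_ge0 => c _; exact: sqr_ge0.
(* This [t] puts [x - t w] in the kernel of [l], where the form is minus a sum of squares. *)
apply: (@reverse_cauchy_schwarz _ _ _ _ _ (l x / l w)) => //.
rewrite qE (_ : l _ = 0) ?expr0n /= ?sub0r ?oppr_le0.
  by apply: sumr_ge0 => c _; exact: sqr_ge0.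
by rewrite {1}/l sumrB -mulr_sumr -/(l x) -/(l w) divfK // subrr.
Qed.

(** The contraction by [s] has rank [m.+2] when [s] is independent. The list [s] is kept general
    because the inductive step calls the statement for every [k :: s]. *)
Lemma hess_hyperbolic m s x : (size s + m.+2)%N = d ->
  bform (hess s) x x * bform (hess s) w w <= bform (hess s) x w ^+ 2.
Proof.
elim: m s x => [|m IHm] s x sd.
  by apply: hess_hyperbolic_rank2; rewrite -sd addn2.
have ww_ge0 : 0 <= bform (hess s) w w.
  by rewrite hess_bform_ww !mulr_ge0 ?ler0n // dbasis_ge0.
have [ww0|ww0] := eqVneq (bform (hess s) w w) 0.
  by rewrite ww0 mulr0 sqr_ge0.
have ww_gt0 : 0 < bform (hess s) w w by rewrite lt0r ww0.
have d1 : (d - (size s).+1 = m.+2)%N by rewrite -sd; lia.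
have d2 : (d - (size s).+2 = m.+1)%N by rewrite -sd; lia.
(* With this [t] the vector [x - t w] is orthogonal to [w] for the Hessian. *)
apply: (@reverse_cauchy_schwarz _ _ _ _ _
  (bform (hess s) x w / bform (hess s) w w)) => //.
apply: (@orthogonal_bform_le0 _ _ _ w) => //.
- by move=> i j; exact: dbasis_ge0.
(* Connectedness: nonzero rows are non-loops. If [i] and [j] are parallel, some [k] is not parallel
   to [i], and by [dbasis_augment] it is not parallel to [j] either. *)
- have nlE i : \sum_j hess s i j * w j != 0 -> 0 < db (i :: s).
    rewrite hess_mulw mulf_eq0 negb_or => /andP[_ n0].
    by rewrite lt0r n0 dbasis_ge0.
  move=> i j /nlE ni /nlE nj.
  have [ij|] := boolP (0 < db [:: i, j & s]); first by left; exact: lt0r_neq0.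
  move=> nij; right.
  have : 0 < \sum_j hess s i j * w j.
    by rewrite hess_mulw mulr_gt0 // d1 ltr0n.
  have [k ik _|nk] := pickP (fun k => 0 < db [:: i, k & s]); last first.
    rewrite big1 ?ltxx // => k _; have /negbT := nk k.
    by rewrite -dbasis_eq0 // => /eqP ->; rewrite mul0r.
  exists k; first exact: lt0r_neq0.
  have [ij|jk] := dbasis_augment w_gt0 ik nj; first by rewrite ij in nij.
  by rewrite dbasis_swap; exact: lt0r_neq0.
- move=> y.
  (* Euler's relation for each second derivative writes the form as a combination of those of the
     contractions, to be bounded one by one. *)
  have eul : m.+1%:R * bform (hess s) y y = \sum_k w k * bform (hess (k :: s)) y y.
    under [RHS]eq_bigr do rewrite /bform mulr_sumr.
    rewrite exchange_big /bform mulr_sumr; apply: eq_bigr => i _.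
    under [RHS]eq_bigr do rewrite mulr_sumr.
    rewrite exchange_big mulr_sumr; apply: eq_bigr => j _.
    have := dbasis_euler w dE [:: i, j & s]; rewrite /= d2 mulrCA => <-.
    rewrite mulr_sumr; apply: eq_bigr => k _.
    by rewrite [in RHS]dbasis_rot3 mulrCA.
  rewrite -(ler_pM2l (ltr0Sn R m)) eul mulr_sumr; apply: ler_sum => k _.
  have yk : \sum_j y j * hess s j k = \sum_i y i * db [:: i, k & s] by [].
  have := IHm (k :: s) y; rewrite /= addSnnS sd => /(_ erefl).
  rewrite (hess_bform_w _ y) hess_bform_ww /= d1 d2 hess_mulw d1 yk.
  set B := bform _ _ _; set S := \sum_i _; set u := m.+2%:R * _.
  have m0 : 0 < m.+1%:R :> R by rewrite ltr0n.
  have wk := w_gt0 k.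
  have u_ge0 : 0 <= u by rewrite mulr_ge0 ?ler0n ?dbasis_ge0.
  (* If [u] is 0, all derivatives along [k :: s] vanish, so [B] is 0, in agreement with the
     convention for division by 0. *)
  have [u0 _|u0] := eqVneq u 0.
    have k0 : db (k :: s) = 0.
      by move/eqP: u0; rewrite mulf_eq0 pnatr_eq0 => /eqP.
    suff -> : B = 0 by rewrite u0 invr0 !(mulr0, mul0r).
    rewrite /B /bform big1 // => i _; rewrite big1 // => j _.
    suff -> : db [:: i, j, k & s] = 0 by rewrite mulr0.
    apply/eqP; rewrite dbasis_eq0 //; apply/negP.
    by move=> /(dbasis_cons_gt0 w_gt0)/(dbasis_cons_gt0 w_gt0); rewrite k0 ltxx.
  have u_gt0 : 0 < u by rewrite lt0r u0.
  move=> loc.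
  have {}loc : B * u <= m.+1%:R * S ^+ 2.
    rewrite -(ler_pM2l m0) (mulrCA _ B).
    by rewrite (_ : m.+1%:R * (_ * _ ^+ 2) = (m.+1%:R * S) ^+ 2) //; ring.
  rewrite (_ : _ * (_ * _) = w k * (m.+1%:R * S ^+ 2 / u)); last by ring.
  by rewrite ler_pM2l // ler_pdivlMr.
- by rewrite bformBl divfK // subrr.
Qed.

End Lorentzian.

(** * The upper bound *)

Section UpperBound.
Variables (R : realType) (E : finType) (M : matroid E).

(** Hyperbolicity is tested on the vector with entries [dbasis M w [:: j]] at [i] and [dbasis M w
    [:: i]] at [j]. It yields the constant [2 (1 - 1/d)] in rank [d], which is then weakened to
    2. *)
Lemma dbasis_correlation (w : E -> R) i j : (forall e, 0 < w e) -> i != j ->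
  0 < dbasis M w [:: i; j] ->
  dbasis M w [:: i; j] * dbasis M w [::] <=
  2 * (dbasis M w [:: i] * dbasis M w [:: j]).
Proof.
move=> w0 nij ij0.
have /(dbasis_gt0P _ w0)[_ [b hb /and3P[ib jb _]]] := ij0.
have [d dE] : exists d, forall b', b' \in bases M -> #|b'| = d.
  by exists #|b| => b' hb'; exact: bases_card hb' hb.
have [m dm] : exists m, (0 + m.+2)%N = d.
  exists d.-2; rewrite -(dE b) // add0n.
  by rewrite (cardsD1 i) ib (cardsD1 j) !inE eq_sym nij jb.
have i0 : 0 < dbasis M w [:: i].
  by apply: (@dbasis_cons_gt0 _ _ _ w _ j); rewrite // dbasis_swap.
have j0 : 0 < dbasis M w [:: j] by exact: dbasis_cons_gt0 ij0.
pose x e := if e == i then dbasis M w [:: j]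
            else if e == j then dbasis M w [:: i] else 0.
have sumx (g : E -> R) : \sum_e x e * g e =
    dbasis M w [:: j] * g i + dbasis M w [:: i] * g j.
  rewrite (bigD1 i) //= (bigD1 j) /= 1?eq_sym // /x eqxx eq_sym (negPf nij) eqxx.
  rewrite big1 ?addr0 // => e /andP[/negPf -> /negPf ->]; exact: mul0r.
have := hess_hyperbolic w0 dE (s := [::]) x dm.
rewrite (hess_bform_w _ dE [::] x) (hess_bform_ww _ dE) /= sumx.
have -> : bform (fun a b => dbasis M w [:: a; b]) x x =
    2 * dbasis M w [:: i] * dbasis M w [:: j] * dbasis M w [:: i; j].
  rewrite /bform (eq_bigr (fun a => x a * \sum_b x b * dbasis M w [:: a; b])).
    rewrite sumx !sumx (dbasis_swap _ _ j i).
    have dii e : dbasis M w [:: e; e] = 0 by rewrite /dbasis /= inE eqxx.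
    by rewrite !dii; ring.
  by move=> a _; rewrite mulr_sumr; apply: eq_bigr => c _; rewrite mulrA.
have -> : (d - 1)%:R = m.+1%:R :> R by rewrite -dm.
have -> : (d - 0)%:R = m.+1%:R + 1 :> R by rewrite -dm natr1.
have : 0 < m.+1%:R :> R by rewrite ltr0n.
move: i0 j0 ij0 (dbasis_ge0 M w0 [::]).
set f := dbasis M w [::]; set bi := dbasis M w [:: i]; set bj := dbasis M w [:: j].
set D := dbasis M w [:: i; j]; set q := m.+1%:R.
move=> bi0 bj0 D0 f0 q0.
have t0 : 0 < 2 * q * (bi * bj) by rewrite !mulr_gt0.
rewrite (_ : _ * (q * _) = 2 * q * (bi * bj) * ((q + 1) * (D * f))); last by ring.
rewrite (_ : _ ^+ 2 = 2 * q * (bi * bj) * (q * (2 * (bi * bj)))); last by ring.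
rewrite ler_pM2l // => le.
have q1 : 0 < q + 1 by rewrite addr_gt0.
rewrite -(ler_pM2l q1); apply: le_trans le _.
by rewrite ler_pM2r ?lerDl ?ler01 // !mulr_gt0.
Qed.

Variables (w : E -> R) (i j : E).
Hypothesis w_gt0 : forall e, 0 < w e.
Hypothesis nij : i != j.

Let mass (A : pred {set E}) := \sum_(b in bases M | A b) weight w b.

(** Factoring out [w i] and [w j] leaves [D * A <= 2 * (B * C)], free of these two weights. They are
    reset to a common [t]: the derivatives along [i] and [j] become [B + t D] and [C + t D], the
    polynomial is at least [A], and [t] tends to 0. *)
Lemma mass_correlation :
  mass (fun b => (i \in b) && (j \in b)) * mass (fun b => (i \notin b) && (j \notin b))
  <= 2 * (mass (fun b => (i \in b) && (j \notin b)) *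
          mass (fun b => (i \notin b) && (j \in b))).
Proof.
pose A := \sum_(b in bases M | (i \notin b) && (j \notin b)) \prod_(e in b) w e.
pose B := \sum_(b in bases M | (i \in b) && (j \notin b)) \prod_(e in b | e != i) w e.
pose C := \sum_(b in bases M | (i \notin b) && (j \in b)) \prod_(e in b | e != j) w e.
pose D := \sum_(b in bases M | (i \in b) && (j \in b))
  \prod_(e in b | (e != i) && (e != j)) w e.
have prodI (P : pred E) : 0 < \prod_(e | P e) w e by exact: prodr_gt0.
have [A0 B0 C0 D0] : [/\ 0 <= A, 0 <= B, 0 <= C & 0 <= D].
  by split; apply: sumr_ge0 => b _; exact: ltW.
suff ABCD : D * A <= 2 * (B * C).
  have -> : mass (fun b => (i \in b) && (j \in b)) = w i * w j * D.
    rewrite mulr_sumr; apply: eq_bigr => b /andP[_ /andP[ib jb]].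
    rewrite /weight (bigD1 i) //= (bigD1 j) /= ?jb 1?eq_sym // mulrA; congr (_ * _).
    by apply: eq_bigl => e; rewrite andbA.
  have -> : mass (fun b => (i \in b) && (j \notin b)) = w i * B.
    rewrite mulr_sumr; apply: eq_bigr => b /andP[_ /andP[ib jb]].
    by rewrite /weight (bigD1 i).
  have -> : mass (fun b => (i \notin b) && (j \in b)) = w j * C.
    rewrite mulr_sumr; apply: eq_bigr => b /andP[_ /andP[ib jb]].
    by rewrite /weight (bigD1 j).
  rewrite -/(mass _) -[mass _]/A.
  rewrite (_ : _ * A = w i * w j * (D * A)); last by ring.
  rewrite (_ : 2 * _ = w i * w j * (2 * (B * C))); last by ring.
  by rewrite ler_pM2l // mulr_gt0.
have [D00|nD] := eqVneq D 0; first by rewrite D00 mul0r !mulr_ge0.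
have {}nD : 0 < D by rewrite lt0r nD.
have bound t : 0 < t -> D * A <= 2 * ((B + t * D) * (C + t * D)).
  move=> t0.
  pose w' e := if (e == i) || (e == j) then t else w e.
  have w'0 e : 0 < w' e by rewrite /w'; case: ifP.
  have Df : dbasis M w' [:: i; j] = D.
    rewrite /dbasis /= inE nij; apply: eq_big => [b|b _]; first by rewrite andbT.
    apply: eq_big => [e|e]; first by rewrite !inE negb_or.
    by rewrite !inE /w' => /andP[_ /negPf ->].
  have Bf : dbasis M w' [:: i] = B + t * D.
    rewrite /dbasis /= (bigID (fun b : {set E} => j \notin b)) /=; congr (_ + _).
      apply: eq_big => [b|b]; first by rewrite andbT andbA.
      case/andP => _ jb; apply: eq_big => [e|e]; first by rewrite !inE.
      rewrite !inE /w' => /andP[eb /negPf ->] /=.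
      by case: eqP => // ej; rewrite -ej eb in jb.
    rewrite mulr_sumr; apply: eq_big => [b|b]; first by rewrite negbK andbT andbA.
    rewrite negbK => /andP[_ jb]; rewrite (bigD1 j) /=; last by rewrite jb inE eq_sym.
    rewrite {1}/w' eqxx orbT; congr (_ * _).
    apply: eq_big => [e|e]; first by rewrite !inE andbA.
    by rewrite !inE /w' => /andP[/andP[_ /negPf ->] /negPf ->].
  have Cf : dbasis M w' [:: j] = C + t * D.
    rewrite /dbasis /= (bigID (fun b : {set E} => i \notin b)) /=; congr (_ + _).
      apply: eq_big => [b|b]; first by rewrite andbT -andbA [(j \in b) && _]andbC.
      case/andP => _ jb; apply: eq_big => [e|e]; first by rewrite !inE.
      rewrite !inE /w' orbC => /andP[eb /negPf ->] /=.
      by case: eqP => // ej; rewrite -ej eb in jb.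
    rewrite mulr_sumr; apply: eq_big => [b|b].
      by rewrite negbK andbT -andbA [(j \in b) && _]andbC.
    rewrite negbK => /andP[_ jb]; rewrite (bigD1 i) /=; last by rewrite jb inE.
    rewrite {1}/w' eqxx; congr (_ * _).
    apply: eq_big => [e|e]; first by rewrite !inE -andbA [(e != j) && _]andbC.
    by rewrite !inE /w' => /andP[/andP[_ /negPf ->] /negPf ->].
  have Af : A <= dbasis M w' [::].
    rewrite /dbasis /= [leRHS](bigID (fun b : {set E} => (i \notin b) && (j \notin b))) /=.
    rewrite -[leLHS]addr0 lerD //; last first.
      by apply: sumr_ge0 => b _; apply: prodr_ge0 => e _; exact: ltW.
    rewrite le_eqVlt; apply/orP; left; apply/eqP.
    apply: eq_big => [b|b]; first by rewrite andbT.
    move=> /andP[_ /andP[ib jb]]; apply: eq_big => [e|e eb]; first by rewrite andbT.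
    rewrite /w'; case: eqP => [ei|_]; first by rewrite -ei eb in ib.
    by case: eqP => [ej|_] //; rewrite -ej eb in jb.
  rewrite -Bf -Cf; apply: le_trans (dbasis_correlation w'0 nij _); rewrite Df //.
  by rewrite ler_pM2l.
apply/ler_addgt0Pr => e e0.
(* For [t <= 1] the excess over [2 * (B * C)] is at most [t K], and [t = e / (K + e)] satisfies both
   [t <= 1] and [t K <= e]. *)
pose K := 2 * (D * (B + C) + D ^+ 2).
have K0 : 0 <= K by rewrite mulr_ge0 // addr_ge0 ?sqr_ge0 // mulr_ge0 // addr_ge0.
have Ke : 0 < K + e by rewrite ltr_wpDl.
pose t := e / (K + e).
have t0 : 0 < t by rewrite divr_gt0.
have tK : t * (K + e) = e by rewrite divfK // lt0r_neq0.
have t1 : t <= 1 by rewrite ler_pdivrMr // mul1r lerDr.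
apply: le_trans (bound t t0) _.
have tt : t ^+ 2 * D ^+ 2 <= t * D ^+ 2.
  by rewrite ler_wpM2r ?sqr_ge0 // expr2 ler_piMl // ltW.
have te : 0 <= t * e by rewrite mulr_ge0 // ltW.
rewrite /K in tK; lra.
Qed.

Lemma prob_mass (A : pred {set E}) :
  prob M w A = mass A / \sum_(b in bases M) weight w b.
Proof.
rewrite /prob /pmf mulr_suml [RHS]big_mkcondl; exact: eq_bigr.
Qed.

Lemma correlation_ratio_le2 : correlation_ratio M w i j <= 2.
Proof.
rewrite /correlation_ratio !prob_mass.
have mass_ge0 A : 0 <= mass A.
  by apply: sumr_ge0 => b _; apply: prodr_ge0 => e _; exact: ltW.
set Z := \sum_(b in _) _.
have Z0 : 0 < Z.
  have [b hb] := bases_nonempty M; rewrite /Z (bigD1 b) //= ltr_wpDr //.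
    by apply: sumr_ge0 => b' _; apply: prodr_ge0 => e _; exact: ltW.
  exact: prodr_gt0.
set x := mass _; set y := mass _; set u := mass _; set v := mass _.
have -> : x / Z * (y / Z) / (u / Z * (v / Z)) = x * y / (u * v).
  have [->|u0] := eqVneq u 0; first by rewrite !mul0r invr0 !mulr0.
  have [->|v0] := eqVneq v 0; first by rewrite !(mul0r, mulr0) invr0 !mulr0.
  by field; rewrite u0 v0 lt0r_neq0.
have [->|uv0] := eqVneq (u * v) 0; first by rewrite invr0 mulr0.
rewrite ler_pdivrMr ?mass_correlation // lt0r uv0 mulr_ge0 //; exact: mass_ge0.
Qed.

End UpperBound.

Lemma alpha_le2 (R : realType) (E : finType) (M : matroid E) :
  (alpha R M <= (2 : R)%:E)%E.
Proof.
rewrite /alpha; case: ifP => _; first by rewrite lee_fin.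
apply: ub_ereal_sup => _ [i [j [w [nij _ _ w0 ->]]]].
by rewrite lee_fin correlation_ratio_le2.
Qed.

(** * Linear matroids *)

Section LinearMatroid.
Variables (F : fieldType) (E : finType) (n : nat) (v : E -> 'rV[F]_n).

Definition vfam (s : {set E}) : seq 'rV[F]_n := [seq v e | e <- enum s].

Lemma vfam_span_mem (s : {set E}) e : e \in s -> v e \in <<vfam s>>%VS.
Proof. by move=> es; apply/memv_span/map_f; rewrite mem_enum. Qed.

Lemma vfam_span_sub (s : {set E}) (U : {vspace 'rV[F]_n}) :
  (forall e, e \in s -> v e \in U) -> (<<vfam s>> <= U)%VS.
Proof.
by move=> sU; apply/span_subvP => _ /mapP[e + ->]; rewrite mem_enum; exact: sU.
Qed.

Lemma vfam_free_sub (s t : {set E}) : s \subset t -> free (vfam t) -> free (vfam s).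
Proof.
move=> st; rewrite (@perm_free _ _ _ (vfam s ++ vfam (t :\: s))); first exact: catl_free.
rewrite -map_cat; apply: perm_map; apply: uniq_perm; rewrite ?enum_uniq //.
  rewrite cat_uniq !enum_uniq andbT /=; apply/hasPn => x.
  by rewrite !mem_enum inE => /andP[].
move=> x; rewrite mem_cat !mem_enum inE; case xs: (x \in s) => //=.
exact: (fintype.subsetP st).
Qed.

Lemma vfam_freeU1 (s : {set E}) e :
  v e \notin <<vfam s>>%VS -> free (vfam s) -> free (vfam (e |: s)).
Proof.
move=> nes fs; have es : e \notin s by apply: contraNN nes; exact: vfam_span_mem.
rewrite (@perm_free _ _ _ (v e :: vfam s)) ?free_cons ?nes //.
rewrite -map_cons; apply: perm_map; apply: uniq_perm; rewrite ?enum_uniq //=.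
  by rewrite mem_enum es enum_uniq.
by move=> x; rewrite inE !mem_enum !inE.
Qed.

Lemma size_vfam (s : {set E}) : size (vfam s) = #|s|.
Proof. by rewrite size_map cardE. Qed.

(** Fixing the size to the ambient dimension [n] is right for a spanning family, as [v_full] will
    ensure. *)
Definition linear_bases : {set {set E}} :=
  [set b : {set E} | (#|b| == n) && free (vfam b)].

Lemma linear_basesE (b : {set E}) :
  (b \in linear_bases) = (#|b| == n) && (<<vfam b>> == fullv)%VS.
Proof.
rewrite inE; case: eqP => //= bn; rewrite /free size_vfam bn eqEdim subvf /=.
rewrite dimvf dim_matrix (mul1r n) eqn_leq andb_idl //.
by move=> _; apply: leq_trans (dim_span _) _; rewrite size_vfam bn.
Qed.

Hypothesis v_full : (<<vfam [set: E]>> = fullv)%VS.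

Lemma linear_extend (s : {set E}) : free (vfam s) ->
  exists2 b, b \in linear_bases & s \subset b.
Proof.
case/(@maxset_exists _ (fun t : {set E} => free (vfam t))) => b /maxsetP[fb bmax] sb.
exists b => //; rewrite inE fb andbT.
have full : <<vfam b>>%VS = fullv.
  apply/eqP; rewrite eqEsubv subvf -v_full; apply: vfam_span_sub => e _.
  apply: contraT => neb; have := bmax _ (vfam_freeU1 neb fb) (finset.subsetUr _ _).
  by move=> eb; move: neb; rewrite vfam_span_mem // -eb !inE eqxx.
by move: fb; rewrite /free full size_vfam dimvf dim_matrix (mul1r n) eq_sym.
Qed.

Lemma linear_nonempty : exists b, b \in linear_bases.
Proof.
have [|b hb _] := @linear_extend finset.set0; last by exists b.
by rewrite /vfam enum_set0; exact: nil_free.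
Qed.

(** Otherwise [b2] would lie in the span of [b1 :\ e], which would be the whole space although it is
    generated by [n - 1] vectors. *)
Lemma linear_exchange (b1 b2 : {set E}) :
  b1 \in linear_bases -> b2 \in linear_bases ->
  forall e, e \in b1 :\: b2 ->
  exists2 f, f \in b2 :\: b1 & f |: (b1 :\ e) \in linear_bases.
Proof.
rewrite [b2 \in _]linear_basesE inE => /andP[/eqP b1n fb1] /andP[_ /eqP b2f] e.
rewrite inE => /andP[eb2 eb1].
have [f /andP[fb2 nf]|all_in] :=
    pickP (fun f => (f \in b2) && (v f \notin <<vfam (b1 :\ e)>>%VS)).
  have fb1' : f \notin b1.
    apply: contraNN nf => fb1'; apply: vfam_span_mem; rewrite !inE fb1' andbT.
    by apply: contraNneq eb2 => <-.
  exists f; first by rewrite inE fb1' fb2.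
  rewrite inE vfam_freeU1 ?(vfam_free_sub _ fb1) ?subD1set // andbT.
  by rewrite cardsU1 !inE (negPf fb1') andbF -b1n (cardsD1 e b1) eb1.
have : (fullv <= <<vfam (b1 :\ e)>>)%VS.
  rewrite -b2f; apply: vfam_span_sub => f fb2.
  by have := all_in f; rewrite fb2 => /negbFE.
move/dimvS; rewrite dimvf dim_matrix (mul1r n) => /leq_trans/(_ (dim_span _)).
by rewrite size_vfam -b1n (cardsD1 e b1) eb1 ltnn.
Qed.

Definition linear_matroid : matroid E :=
  Matroid linear_nonempty linear_exchange.

Lemma linear_matroid_representable : representable linear_matroid F.
Proof.
exists n, v => s; apply/exists_inP/idP => [[b hb sb]|/linear_extend[b hb sb]].
  by apply: vfam_free_sub sb _; move: hb; rewrite inE => /andP[].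
by exists b.
Qed.

End LinearMatroid.

Lemma fullv_delta (F : fieldType) n (U : {vspace 'rV[F]_n}) :
  (forall k, delta_mx 0 k \in U) -> U = fullv.
Proof.
move=> dU; apply/eqP; rewrite eqEsubv subvf; apply/subvP => x _.
by rewrite (row_sum_delta x); apply: memv_suml => k _; apply: memvZ.
Qed.

(** The column [c] is a nonzero linear functional that vanishes on the family. It serves as a
    certificate that a set is not a basis. *)
Lemma vfam_not_full (F : fieldType) (E : finType) n (v : E -> 'rV[F]_n)
    (s : {set E}) (c : 'cV[F]_n) :
  c != 0 -> (forall e, e \in s -> v e *m c = 0) -> (<<vfam v s>> != fullv)%VS.
Proof.
move=> c0 vc; apply: contraNneq c0 => full.
have : (fullv <= lker (linfun (mulmxr c : 'rV[F]_n -> 'rV[F]_1)))%VS.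
  rewrite -full; apply: vfam_span_sub => e es.
  by rewrite memv_ker lfunE /= vc.
move/subvP => ker; apply/eqP/matrixP => k l; rewrite ord1 [RHS]mxE.
have := ker (delta_mx 0 k) (memvf _); rewrite memv_ker lfunE /= -rowE => /eqP.
by move/matrixP/(_ 0 0); rewrite !mxE.
Qed.

(** * A pencil of four lines in rank five *)

Lemma leq_sum_card_disjoint (I T : finType) (X : I -> {set T}) (S : {set T}) :
  (forall k, X k \subset S) -> (forall k l b, b \in X k -> b \in X l -> k = l) ->
  (\sum_k #|X k| <= #|S|)%N.
Proof.
move=> XS Xdisj; rewrite (eq_bigr (fun k => \sum_(b in X k) 1)%N); last first.
  by move=> k _; rewrite sum1_card.
rewrite -partition_disjoint_bigcup ?sum1_card; last first.
  move=> k l; apply: contraNT => /pred0Pn[b /andP[/= bk bl]].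
  exact/eqP/(Xdisj _ _ _ bk bl).
by apply/subset_leq_card/bigcupsP => k _.
Qed.

Lemma leq_card_bigcup (I T : finType) (P : pred I) (X : I -> {set T}) :
  (#|\bigcup_(k | P k) X k| <= \sum_(k | P k) #|X k|)%N.
Proof.
elim/big_rec2: _ => [|k n A _ le]; first by rewrite cards0.
by apply: leq_trans (leq_card_setU _ _) _; rewrite leq_add2l.
Qed.

Section Pencil.
Variables (F : fieldType) (N : nat).
Hypothesis N_gt1 : (1 < N)%N.
Hypothesis nat_inj : forall s t : 'I_N, s%:R = t%:R :> F -> s = t.

Local Notation E := (bool + 'I_4 * 'I_N)%type.

(* [inl false] is a point [e_0], the points [inr (k, t)] lie on four independent
   lines through it, and [inl true] is the sum of the [e_k]. *)
Definition pencil_vec (x : E) : 'rV[F]_5 :=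
  match x with
  | inl true => \sum_(k < 4) delta_mx 0 (lift ord0 k)
  | inl false => delta_mx 0 ord0
  | inr (k, t) => delta_mx 0 (lift ord0 k) + t%:R *: delta_mx 0 ord0
  end.

Local Notation vec := pencil_vec.
Local Notation i := (inl true : E).
Local Notation j := (inl false : E).

Definition profile (b : {set E}) (k : 'I_4) := #|[set t | inr (k, t) \in b]|.

(** Bases are counted by their numbers of points on the four lines: apart from transversals, these
    data decide whether a set is a basis, and a class is counted by a product of binomials. *)
Definition profile_class (bi bj : bool) (m : 'I_4 -> nat) : {set {set E}} :=
  [set b : {set E} |
    [&& (i \in b) == bi, (j \in b) == bj & [forall k, profile b k == m k]]].

Lemma card_profile_class bi bj m :
  #|profile_class bi bj m| = (\prod_k 'C(N, m k))%N.
Proof.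
pose mk (S : {ffun 'I_4 -> {set 'I_N}}) : {set E} :=
  [set x : E | match x with inl c => if c then bi else bj | inr kt => kt.2 \in S kt.1 end].
have mk_inj : injective mk.
  move=> S S' /setP SS; apply/ffunP => k; apply/setP => t.
  by have := SS (inr (k, t)); rewrite !inE.
pose fam := family (fun k : 'I_4 => [pred A : {set 'I_N} | #|A| == m k]).
have -> : profile_class bi bj m = mk @: [set S | S \in fam].
  apply/setP => b; rewrite inE; apply/and3P/imsetP => [[/eqP ib /eqP jb /forallP pb]|].
    exists [ffun k => [set t | inr (k, t) \in b]].
      by rewrite inE; apply/familyP => k; rewrite ffunE inE; exact: pb.
    apply/setP => -[[]|[k t]]; rewrite !inE //= ffunE !inE //.
  move=> [S]; rewrite inE => /familyP fS ->; rewrite !inE !eqxx; split=> //.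
  apply/forallP => k; have := fS k; rewrite inE => /eqP <-; apply/eqP.
  by apply: eq_card => t; rewrite !inE.
rewrite card_imset // cardsE card_family foldrE big_image; apply: eq_bigr => k _.
by rewrite -[in RHS](card_ord N) -card_draws cardsE; apply: eq_card => A; rewrite !inE.
Qed.

Lemma card_profile (b : {set E}) :
  #|b| = ((i \in b) + (j \in b) + \sum_k profile b k)%N.
Proof.
rewrite -sum1_card big_mkcond big_sumType /= big_bool /=; congr (_ + _ + _)%N.
rewrite (eq_bigr (fun k => \sum_(t < N) if inr (k, t) \in b then 1%N else 0%N)).
  by rewrite pair_big; apply: eq_bigr => -[k t] _.
by move=> k _; rewrite -big_mkcond sum1_card; apply: eq_card => t; rewrite !inE.
Qed.

Lemma profile_gt0P (b : {set E}) k :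
  reflect (exists t, inr (k, t) \in b) (0 < profile b k)%N.
Proof.
apply: (iffP card_gt0P) => -[t]; first by rewrite inE; exists t.
by move=> tb; exists t; rewrite inE.
Qed.

Lemma pencil_basisE (b : {set E}) :
  (b \in linear_bases vec) = (#|b| == 5) && (<<vfam vec b>> == fullv)%VS.
Proof. exact: linear_basesE. Qed.

Let delta_pt (U : {vspace 'rV[F]_5}) k (t : 'I_N) :
  delta_mx 0 ord0 \in U -> vec (inr (k, t)) \in U -> delta_mx 0 (lift ord0 k) \in U.
Proof.
move=> U0 Ut; rewrite -[delta_mx _ _](addrK (t%:R *: delta_mx 0 ord0)).
by apply: memvB => //; exact: memvZ.
Qed.

(** Two points of one line differ by a nonzero multiple of [e_0]; from [e_0] and a point of each
    line one recovers every [e_l]. *)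
Lemma pencil_span_line (b : {set E}) k :
  (forall k, 0 < profile b k)%N -> (1 < profile b k)%N -> (<<vfam vec b>> = fullv)%VS.
Proof.
move=> p1 /card_gt1P[s [t []]]; rewrite !inE => sb tb st.
have U0 : delta_mx 0 ord0 \in <<vfam vec b>>%VS.
  have st0 : s%:R - t%:R != 0 :> F.
    by rewrite subr_eq0; apply: contraNneq st => /nat_inj ->.
  rewrite (_ : delta_mx _ _ = (s%:R - t%:R)^-1 *: (vec (inr (k, s)) - vec (inr (k, t)))).
    by apply/memvZ/memvB; apply: vfam_span_mem.
  by rewrite /= opprD addrACA subrr add0r -scalerBl scalerA mulVf // scale1r.
apply: fullv_delta => l; case: (unliftP ord0 l) => [a ->|-> //].
have /profile_gt0P[r rb] := p1 a.
by apply: delta_pt U0 _; apply: (vfam_span_mem vec rb).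
Qed.

(** Here [e_0] is given by [j], and the missing [e_k] is [i] minus the three others. *)
Lemma pencil_span_apex (b : {set E}) k : i \in b -> j \in b ->
  (forall l, l != k -> 0 < profile b l)%N -> (<<vfam vec b>> = fullv)%VS.
Proof.
move=> ib jb p1.
have U0 : delta_mx 0 ord0 \in <<vfam vec b>>%VS by exact: (vfam_span_mem vec jb).
have Ul l : l != k -> delta_mx 0 (lift ord0 l) \in <<vfam vec b>>%VS.
  move=> /p1/profile_gt0P[r rb].
  by apply: delta_pt U0 _; apply: (vfam_span_mem vec rb).
apply: fullv_delta => l; case: (unliftP ord0 l) => [a ->|-> //].
have [->|/Ul //] := eqVneq a k.
have -> : delta_mx 0 (lift ord0 k) =
    vec i - \sum_(l < 4 | l != k) delta_mx 0 (lift ord0 l).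
  by rewrite /= (bigD1 k) //= addrK.
by apply: memvB; [exact: (vfam_span_mem vec ib)|apply: memv_suml].
Qed.

Let cE (c : 'cV[F]_5) l : delta_mx 0 l *m c = (c l 0)%:M :> 'M_1.
Proof. by rewrite -rowE; apply/matrixP => x y; rewrite !ord1 !mxE mulr1n. Qed.

Lemma vec_mul (c : 'cV[F]_5) x : vec x *m c =
  (match x with
   | inl true => \sum_(k < 4) c (lift ord0 k) 0
   | inl false => c ord0 0
   | inr (k, t) => c (lift ord0 k) 0 + t%:R * c ord0 0 end)%:M.
Proof.
case: x => [[]|[k t]] /=; last by rewrite mulmxDl -scalemxAl !cE raddfD /= scale_scalar_mx.
  rewrite mulmx_suml raddf_sum; apply: eq_bigr => k _; exact: cE.
exact: cE.
Qed.

(** Otherwise the coordinate along [e_k] vanishes on [b]. *)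
Lemma pencil_line_hit (b : {set E}) k :
  b \in linear_bases vec -> i \notin b -> (0 < profile b k)%N.
Proof.
rewrite pencil_basisE => /andP[_ bfull] ib; rewrite lt0n; apply: contraTneq bfull => pk.
apply: (@vfam_not_full _ _ _ _ _ (delta_mx (lift ord0 k) 0)).
  by apply/eqP => /matrixP/(_ (lift ord0 k) 0); rewrite !mxE !eqxx => /eqP; rewrite oner_eq0.
move=> [[]|[l t]] xb; first by rewrite xb in ib.
  by rewrite vec_mul mxE raddf0.
rewrite vec_mul !mxE mulr0 addr0 andbT; have [lk|] := eqVneq (lift ord0 l) (lift ord0 k).
  have := lift_inj lk => lk'; rewrite lk' in xb.
  suff : (0 < profile b k)%N by rewrite pk.
  by apply/profile_gt0P; exists t.
by rewrite raddf0.
Qed.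

(** Otherwise the difference of the coordinates along [e_k] and [e_l] vanishes on [b], including at
    [i], whose coordinates are equal. *)
Lemma pencil_lines_hit (b : {set E}) k l :
  b \in linear_bases vec -> j \notin b -> k != l ->
  (0 < profile b k)%N || (0 < profile b l)%N.
Proof.
rewrite pencil_basisE => /andP[_ bfull] jb kl; apply: contraTT bfull.
rewrite negb_or -!eqn0Ngt => /andP[/eqP pk /eqP pl].
have kl' : (lift ord0 k == lift ord0 l) = false by rewrite (inj_eq lift_inj) (negPf kl).
apply: (@vfam_not_full _ _ _ _ _
    (delta_mx (lift ord0 k) 0 - delta_mx (lift ord0 l) 0)).
  apply/eqP => /matrixP/(_ (lift ord0 k) 0); rewrite !mxE !eqxx kl' subr0 => /eqP.
  by rewrite oner_eq0.
move=> [[]|[a t]] xb; last first.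
- rewrite vec_mul !mxE subrr mulr0 addr0 !andbT !(inj_eq lift_inj).
  have nprof c : profile b c = 0%N -> (a == c) = false.
    move=> pc; apply: contra_eqF pc => /eqP ac; rewrite -lt0n.
    by apply/profile_gt0P; exists t; rewrite -ac.
  by rewrite !nprof // subrr raddf0.
- by rewrite xb in jb.
rewrite vec_mul (eq_bigr (fun c => (c == k)%:R - (c == l)%:R)); last first.
  by move=> c _; rewrite !mxE !andbT !(inj_eq lift_inj).
have one c : \sum_(a < 4) (a == c)%:R = 1 :> F.
  by rewrite (bigD1 c) //= eqxx big1 ?addr0 // => a /negPf ->.
by rewrite sumrB !one subrr raddf0.
Qed.

(** The functional sending [e_0] to 1 and [e_k] to [- f k] kills the points [e_k + f(k) e_0], and
    takes at [i] the value minus the sum of the [f k]. *)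
Lemma pencil_transversal (b : {set E}) (f : 'I_4 -> 'I_N) :
  b \in linear_bases vec -> j \notin b ->
  (forall k t, inr (k, t) \in b -> t = f k) -> \sum_k (f k)%:R != 0 :> F.
Proof.
rewrite pencil_basisE => /andP[_ bfull] jb bf; apply: contraTneq bfull => f0.
apply: (@vfam_not_full _ _ _ _ _
  (\col_l if unlift ord0 l is Some k then - (f k)%:R else 1)).
  apply/eqP => /matrixP/(_ ord0 0); rewrite !mxE unlift_none => /eqP.
  by rewrite oner_eq0.
move=> [[]|[a t]] xb; last first.
- by rewrite vec_mul !mxE liftK unlift_none mulr1 (bf _ _ xb) addNr raddf0.
- by rewrite xb in jb.
rewrite vec_mul (eq_bigr (fun c => - (f c)%:R)); last by move=> c _; rewrite mxE liftK.
by rewrite sumrN f0 oppr0 raddf0.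
Qed.

Let vfull : (<<vfam vec [set: E]>> = fullv)%VS.
Proof.
have profT k : profile [set: E] k = N.
  by rewrite -[RHS](card_ord N) -cardsT; apply: eq_card => t; rewrite !inE.
apply: (@pencil_span_line _ ord0) => [k|]; rewrite profT //; exact: ltnW.
Qed.

(** * Counting the bases of the pencil matroid *)

Definition pencil : matroid E := linear_matroid vfull.

Definition pencil_class (bi bj : bool) : {set {set E}} :=
  [set b in bases pencil | ((i \in b) == bi) && ((j \in b) == bj)].

Let one : 'I_4 -> nat := fun=> 1%N.

Let prod_others (k : 'I_4) : (\prod_(l < 4 | l != k) N = N ^ 3)%N.
Proof. by rewrite prod_nat_const cardC1 card_ord. Qed.

Let card_transversals bi bj : #|profile_class bi bj one| = (N ^ 4)%N.
Proof.
rewrite card_profile_class; under eq_bigr do rewrite bin1.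
by rewrite prod_nat_const card_ord.
Qed.

Let sum_one (P : pred 'I_4) (m : 'I_4 -> nat) : (forall k, P k -> 0 < m k)%N ->
  (\sum_(k | P k) m k = \sum_(k | P k) (m k).-1 + #|P|)%N.
Proof.
move=> m0; rewrite -sum1_card -big_split; apply: eq_bigr => k /m0 /=.
by rewrite addn1 => /prednK.
Qed.

Let all_one (m : 'I_4 -> nat) : (forall k, 0 < m k)%N -> (\sum_k m k = 4)%N ->
  forall k, m k = 1%N.
Proof.
move=> m0; rewrite sum_one // card_ord => /(congr1 (subn^~ 4)); rewrite addnK /= => /eqP.
rewrite sum_nat_eq0 => /forallP m1 k; apply/eqP; rewrite -(prednK (m0 k)) eqSS.
exact: m1.
Qed.

(** The classes in the numerator of the ratio are bounded from below and those in the denominator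
    from above. Here the line [k] carries two points and the other three lines one each. *)
Lemma pencil_class_neither : (4 * ('C(N, 2) * N ^ 3) <= #|pencil_class false false|)%N.
Proof.
pose m (k l : 'I_4) := if l == k then 2 else 1%N.
have -> : (4 * ('C(N, 2) * N ^ 3) = \sum_(k < 4) 'C(N, 2) * N ^ 3)%N.
  by rewrite sum_nat_const card_ord.
rewrite (eq_bigr (fun k => #|profile_class false false (m k)|)); last first.
  move=> k _; rewrite card_profile_class (bigD1 k) //= {1}/m eqxx; congr (_ * _)%N.
  rewrite -(prod_others k); by apply: eq_bigr => l /negPf lk; rewrite /m lk bin1.
apply: leq_sum_card_disjoint => [k|k l b]; last first.
  rewrite !inE => /and3P[_ _ /forallP/(_ k)/eqP pk] /and3P[_ _ /forallP/(_ k)].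
  by rewrite pk /m eqxx; case: (eqVneq k l).
apply/fintype.subsetP => b; rewrite [in X in X -> _]inE => /and3P[/eqP ib /eqP jb /forallP pb].
have p l : profile b l = m k l by exact/eqP.
rewrite inE ib jb !eqxx !andbT -[bases _]/(linear_bases vec) pencil_basisE.
rewrite (@pencil_span_line _ k) ?eqxx ?andbT => [|l|]; last 2 first.
- by rewrite p /m; case: eqP.
- by rewrite p /m eqxx.
rewrite card_profile ib jb (bigD1 k) //= p {1}/m eqxx (eq_bigr one) => [|l /negPf lk].
  by rewrite sum_nat_const cardC1 card_ord.
by rewrite p /m lk.
Qed.

Lemma pencil_class_both : (4 * N ^ 3 <= #|pencil_class true true|)%N.
Proof.
pose m (k l : 'I_4) := if l == k then 0%N else 1%N.
have -> : (4 * N ^ 3 = \sum_(k < 4) N ^ 3)%N by rewrite sum_nat_const card_ord.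
rewrite (eq_bigr (fun k => #|profile_class true true (m k)|)); last first.
  move=> k _; rewrite card_profile_class (bigD1 k) //= {1}/m eqxx bin0 mul1n.
  rewrite -(prod_others k); by apply: eq_bigr => l /negPf lk; rewrite /m lk bin1.
apply: leq_sum_card_disjoint => [k|k l b]; last first.
  rewrite !inE => /and3P[_ _ /forallP/(_ k)/eqP pk] /and3P[_ _ /forallP/(_ k)].
  by rewrite pk /m eqxx; case: (eqVneq k l).
apply/fintype.subsetP => b; rewrite [in X in X -> _]inE => /and3P[/eqP ib /eqP jb /forallP pb].
have p l : profile b l = m k l by exact/eqP.
rewrite inE ib jb !eqxx !andbT -[bases _]/(linear_bases vec) pencil_basisE.
rewrite (@pencil_span_apex _ k) ?eqxx ?andbT => // [|l /negPf lk]; last first.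
  by rewrite p /m lk.
rewrite card_profile ib jb (bigD1 k) //= p {1}/m eqxx (eq_bigr one) => [|l /negPf lk].
  by rewrite sum_nat_const cardC1 card_ord.
by rewrite p /m lk.
Qed.

(** Without [i] a basis meets every line, so its four points other than [j] form a transversal. *)
Lemma pencil_class_apex : (#|pencil_class false true| <= N ^ 4)%N.
Proof.
rewrite -(card_transversals false true).
apply/subset_leq_card/fintype.subsetP => b.
rewrite inE => /and3P[hb /eqP ib /eqP jb].
rewrite inE ib jb !eqxx /=; apply/forallP => k; apply/eqP; apply: all_one => [l|].
  by apply: pencil_line_hit => //; rewrite ib.
have : #|b| = 5 by move: hb; rewrite -[bases _]/(linear_bases vec) pencil_basisE => /andP[/eqP].
by rewrite card_profile ib jb => -[].
Qed.

Definition transversal_bases : {set {set E}} :=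
  [set b in bases pencil | b \in profile_class true false one].

(** A basis with [i] and without [j] misses at most one line. If it misses [l], its four points lie
    on three lines, so exactly one line [k] carries two; there are 12 pairs [(l, k)]. *)
Lemma pencil_class_sum :
  (#|pencil_class true false| <= #|transversal_bases| + 12 * ('C(N, 2) * N ^ 2))%N.
Proof.
pose m (l k a : 'I_4) := if a == l then 0%N else if a == k then 2 else 1%N.
pose X := \bigcup_l \bigcup_(k | k != l) profile_class true false (m l k).
have cX : (#|X| <= 12 * ('C(N, 2) * N ^ 2))%N.
  have -> : (12 * ('C(N, 2) * N ^ 2) =
      \sum_(l < 4) \sum_(k < 4 | k != l) 'C(N, 2) * N ^ 2)%N.
    rewrite (eq_bigr (fun=> 3 * ('C(N, 2) * N ^ 2)))%N => [|l _]; last first.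
      by rewrite sum_nat_const cardC1 card_ord.
    by rewrite sum_nat_const card_ord [RHS]mulnA.
  apply: leq_trans (leq_card_bigcup _ _) _; apply: leq_sum => l _.
  apply: leq_trans (leq_card_bigcup _ _) _; apply: leq_sum => k kl.
  rewrite card_profile_class (bigD1 l) //= {1}/m eqxx bin0 mul1n.
  rewrite (bigD1 k) //= {1}/m (negPf kl) eqxx leq_pmul2l ?bin_gt0 //.
  rewrite (eq_bigr (fun=> N)) => [|a /andP[/negPf al /negPf ak]]; last first.
    by rewrite /m al ak bin1.
  rewrite prod_nat_const (_ : #|_| = 2) //.
  rewrite (_ : #|_| = #|~: [set l; k]|); last first.
    by apply: eq_card => a; rewrite !inE negb_or.
  by apply/eqP; rewrite -(eqn_add2l #|[set l; k]|) cardsC card_ord cards2 [l == k]eq_sym kl.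
apply: leq_trans (leq_add (leqnn _) cX); apply: leq_trans (leq_card_setU _ _).
apply/subset_leq_card/fintype.subsetP => b; rewrite inE => /and3P[hb /eqP ib /eqP jb].
have sum4 : (\sum_k profile b k = 4)%N.
  have : #|b| = 5.
    by move: hb; rewrite -[bases _]/(linear_bases vec) pencil_basisE => /andP[/eqP].
  by rewrite card_profile ib jb => -[].
rewrite inE; apply/orP.
have [l /eqP l0|n0] := pickP (fun l => profile b l == 0%N); [right|left]; last first.
  rewrite inE hb inE ib jb !eqxx /=; apply/forallP => k; apply/eqP; apply: all_one => // a.
  by rewrite lt0n n0.
have pos a : a != l -> (0 < profile b a)%N.
  move=> al; have := pencil_lines_hit (k := a) (l := l) hb _ al.
  by rewrite l0 orbF; apply; rewrite jb.
have /sum_nat_eq1 [k [kl pk po]] : (\sum_(a | a != l) (profile b a).-1 == 1)%N.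
  move: sum4; rewrite (bigD1 l) //= l0 add0n sum_one // cardC1 card_ord.
  by move=> /(congr1 (subn^~ 3)); rewrite addnK /= => ->.
apply/bigcupP; exists l => //; apply/bigcupP; exists k => //.
rewrite inE ib jb !eqxx /=; apply/forallP => a; apply/eqP; rewrite /m.
have [->//|al] := eqVneq a l.
have [->|ak] := eqVneq a k; first by rewrite -(prednK (pos _ kl)) pk.
by rewrite -(prednK (pos _ al)) po.
Qed.

Lemma transversal_bases_le : (#|transversal_bases| <= N ^ 4)%N.
Proof.
rewrite -(card_transversals true false).
by apply/subset_leq_card/fintype.subsetP => b; rewrite inE => /andP[].
Qed.

(* Three of the four points of a transversal determine the fourth one for which
   the coordinates sum to zero modulo the characteristic. *)
Lemma transversal_bases_pchar : N \in [pchar F] ->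
  (#|transversal_bases| + N ^ 3 <= N ^ 4)%N.
Proof.
move=> charN.
rewrite -(card_transversals true false).
have N0 : (0 < N)%N by exact: ltnW.
(* The opposite of the sum modulo [N]; the outer reduction matters when the sum is divisible by
   [N]. *)
pose last_pt (g : {ffun 'I_3 -> 'I_N}) : 'I_N :=
  Ordinal (ltn_pmod (N - (\sum_a g a) %% N) N0).
pose f (g : {ffun 'I_3 -> 'I_N}) (k : 'I_4) : 'I_N :=
  if unlift ord0 k is Some a then g a else last_pt g.
pose B (g : {ffun 'I_3 -> 'I_N}) : {set E} :=
  [set x | match x with inl c => c | inr kt => kt.2 == f g kt.1 end].
have B_inj : injective B.
  move=> g g' /setP gg; apply/ffunP => a; have := gg (inr (lift ord0 a, g a)).
  by rewrite !inE /= /f liftK eqxx => /esym/eqP.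
have <- : #|B @: [set: {ffun 'I_3 -> 'I_N}]| = (N ^ 3)%N.
  by rewrite card_imset // cardsT card_ffun !card_ord.
have f0 g : \sum_k (f g k)%:R = 0 :> F.
  rewrite big_ord_recl {1}/f unlift_none (eq_bigr (fun a => (g a)%:R)); last first.
    by move=> a _; rewrite /f liftK.
  rewrite -natr_sum -natrD; apply/eqP; rewrite -(dvdn_pcharf charN) /=.
  rewrite /dvdn modnDml -modnDmr subnK ?modnn //.
  by apply: ltnW; rewrite ltn_mod.
(* It remains to find [N ^ 3] transversals that are not bases: the sets [B g]. *)
rewrite -leq_subRL; last first.
  by apply/subset_leq_card/fintype.subsetP => b; rewrite inE => /andP[].
have -> : (#|profile_class true false one| - #|transversal_bases|)%N =
    #|profile_class true false one :\: transversal_bases|.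
  rewrite cardsD; congr (_ - _)%N; apply: eq_card => b.
  rewrite [in RHS]inE; case bp: (b \in profile_class _ _ _) => //=.
  by rewrite inE bp andbF.
apply/subset_leq_card/fintype.subsetP => _ /imsetP[g _ ->].
rewrite inE; apply/andP; split; last first.
  rewrite 3!inE !eqxx /=; apply/forallP => k; apply/eqP; apply/eqP/cards1P.
  by exists (f g k); apply/setP => t; rewrite !inE.
apply/negP; rewrite inE => /andP[hb _].
have := pencil_transversal (f := f g) hb _ _; rewrite f0 eqxx => bad.
suff : false by [].
apply: bad; first by rewrite inE.
by move=> k t; rewrite inE /= => /eqP.
Qed.

End Pencil.

(** * The lower bound *)

(** The basis [b1] shows that [i] and [j] are not loops, and [b2] that they are not coloops. *)
Lemma correlation_ratio_le_alpha (R : realType) (E : finType) (M : matroid E)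
    (w : E -> R) (i j : E) (b1 b2 : {set E}) :
  i != j -> (forall e, 0 < w e) ->
  b1 \in bases M -> i \in b1 -> j \in b1 ->
  b2 \in bases M -> i \notin b2 -> j \notin b2 ->
  ((correlation_ratio M w i j)%:E <= alpha R M)%E.
Proof.
move=> nij w0 hb1 ib1 jb1 hb2 ib2 jb2.
have regular e : e \in b1 -> e \notin b2 -> ~~ loop M e /\ ~~ coloop M e.
  move=> e1 e2; split.
    by apply/negP => /forall_inP/(_ b1 hb1); rewrite e1.
  by apply/negP => /forall_inP/(_ b2 hb2); rewrite (negPf e2).
rewrite /alpha; case: ifP => [/forallP/(_ i)|_].
  by have [/negPf -> /negPf ->] := regular i ib1 ib2.
apply: ereal_sup_ubound; exists i, j, w; split => //; exact: regular.
Qed.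

Lemma natr_ord_inj (F : fieldType) (N : nat) :
  (forall m, (0 < m < N)%N -> m%:R != 0 :> F) ->
  forall s t : 'I_N, s%:R = t%:R :> F -> s = t.
Proof.
move=> nz s t; wlog st : s t / (s <= t)%N.
  by case: (leqP s t) => [st|/ltnW ts] wl e; [exact: wl|exact/esym/wl].
move=> e; apply/val_inj/eqP; rewrite eqn_leq st /= -subn_eq0 -leqn0 leqNgt.
apply/negP => ts; have := nz (t - s)%N; rewrite ts (leq_ltn_trans (leq_subr _ _)) //=.
by rewrite natrB // e subrr eqxx => /(_ isT).
Qed.

(** * The correlation ratio of the pencil matroid at unit weights *)

Section PencilCorrelation.
Variables (R : realType) (F : fieldType) (N : nat).
Hypothesis N_gt1 : (1 < N)%N.
Hypothesis nat_inj : forall s t : 'I_N, s%:R = t%:R :> F -> s = t.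

Local Notation M := (pencil N_gt1 nat_inj).
Local Notation cls := (pencil_class N_gt1 nat_inj).
Local Notation n := (N%:R : R).

(** The numerator is at least [8 (n - 1) n^7] and the denominator at most
    [n^4 (T + 6 (n - 1) n^3)]. *)
Lemma pencil_ratio (T : nat) :
  (#|transversal_bases N_gt1 nat_inj| <= T)%N ->
  8 * (n - 1) * n ^+ 3 / (T%:R + 6 * (n - 1) * n ^+ 3) <=
  correlation_ratio M (fun=> 1 : R) (inl true) (inl false).
Proof.
move=> trT.
have massE (A : pred _) bi bj :
    (forall b, A b = ((inl true \in b) == bi) && ((inl false \in b) == bj)) ->
    \sum_(b in bases M | A b) weight (fun=> 1 : R) b = #|cls bi bj|%:R.
  move=> AE; rewrite -sum1_card natr_sum; apply: eq_big => [b|b _].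
    by rewrite [RHS]inE AE.
  by rewrite /weight big1.
have m11 := massE (fun b => (inl true \in b) && (inl false \in b)) true true.
have m00 := massE (fun b => (inl true \notin b) && (inl false \notin b)) false false.
have m10 := massE (fun b => (inl true \in b) && (inl false \notin b)) true false.
have m01 := massE (fun b => (inl true \notin b) && (inl false \in b)) false true.
(* The upper bound serves here to show that the denominator is positive, because the numerator
   is. *)
have := @mass_correlation R _ M (fun=> 1) (inl true) (inl false) (fun=> ltr01) isT.
have Z0 : 0 < \sum_(b in bases M) weight (fun=> 1 : R) b.
  have [b hb] := bases_nonempty M; rewrite (bigD1 b) //= ltr_wpDr //.
    by apply: sumr_ge0 => b' _; apply: prodr_ge0.
  exact: prodr_gt0.
rewrite /correlation_ratio !prob_mass m11 ?m00 ?m10 ?m01;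
  try by move=> b; rewrite ?eqb_id ?eqbF_neg.
move: Z0; set Z := \sum_(b in _) _.
have := pencil_class_neither N_gt1 nat_inj; have := pencil_class_both N_gt1 nat_inj.
have := pencil_class_apex N_gt1 nat_inj; have := pencil_class_sum N_gt1 nat_inj.
move: #|cls true true| #|cls false false| #|cls true false| #|cls false true| => d a b c.
move=> leb lec led lea Z0 lebc.
have {}leb : (b <= T + 12 * ('C(N, 2) * N ^ 2))%N by rewrite (leq_trans leb) // leq_add2r.
have N1 : (1 <= N)%N by exact: ltnW.
have binE : 'C(N, 2)%:R = n * (n - 1) / 2 :> R.
  apply: (canRL (mulfK _)); rewrite ?pnatr_eq0 // -[2]/(2%:R) -natrM -[n - 1](natrB R N1).
  by rewrite -natrM -[2%N]/(2`!) bin_ffact ffactnS ffactn1 subn1.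
have n1 : 1 < n by rewrite (ltr_nat R 1).
move: leb lec led lea; rewrite -!(ler_nat R) !(natrX, natrD, natrM) binE => leb lec led lea.
have n0 : 0 < n by rewrite (lt_trans ltr01).
have q0 : 0 < n - 1 by rewrite subr_gt0.
have a0 : 0 < a%:R :> R by apply: lt_le_trans lea; rewrite !(mulr_gt0, exprn_gt0).
have d0 : 0 < d%:R :> R by apply: lt_le_trans led; rewrite !(mulr_gt0, exprn_gt0).
have bc0 : 0 < b%:R * c%:R :> R.
  by rewrite -(pmulr_rgt0 _ (ltr0n R 2)) (lt_le_trans _ lebc) // mulr_gt0.
have [b0 c0] : b%:R != 0 :> R /\ c%:R != 0 :> R.
  by move: (lt0r_neq0 bc0); rewrite mulf_eq0 negb_or => /andP[].
have -> : d%:R / Z * (a%:R / Z) / (b%:R / Z * (c%:R / Z)) = a%:R * d%:R / (b%:R * c%:R).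
  by field; rewrite b0 c0 lt0r_neq0.
rewrite ler_pdivlMr //.
set t := T%:R + _.
have t0 : 0 < t by rewrite ltr_wpDl ?ler0n // !(mulr_gt0, exprn_gt0).
have bt : b%:R <= t.
  by apply: le_trans leb _; rewrite le_eqVlt /t; apply/orP; left; apply/eqP; field.
apply: (@le_trans _ _ (8 * (n - 1) * n ^+ 3 / t * (t * n ^+ 4))).
  by rewrite ler_pM2l ?ler_pM ?ler0n // divr_gt0 // !(mulr_gt0, exprn_gt0).
apply: (@le_trans _ _ (4 * (n * (n - 1) / 2 * n ^+ 3) * (4 * n ^+ 3))).
  by rewrite le_eqVlt; apply/orP; left; apply/eqP; field; rewrite lt0r_neq0.
by apply: ler_pM => //; rewrite ltW // !(mulr_gt0, exprn_gt0, divr_gt0).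
Qed.

Lemma pencil_ratio_le_alpha_field :
  ((correlation_ratio M (fun=> 1 : R) (inl true) (inl false))%:E <= alpha_field R F)%E.
Proof.
have pos bi bj m : (0 < m)%N -> (m <= #|cls bi bj|)%N ->
    exists b, [/\ b \in bases M, (inl true \in b) = bi & (inl false \in b) = bj].
  move=> m0 /(leq_trans m0)/card_gt0P[b]; rewrite inE.
  by case/and3P => hb /eqP ib /eqP jb; exists b.
have N3 : (0 < N ^ 3)%N by rewrite expn_gt0 ltnW.
have [|b1 [hb1 ib1 jb1]] := pos true true _ _ (pencil_class_both N_gt1 nat_inj).
  by rewrite muln_gt0 N3.
have [|b2 [hb2 ib2 jb2]] := pos false false _ _ (pencil_class_neither N_gt1 nat_inj).
  by rewrite 2!muln_gt0 bin_gt0 N_gt1 N3.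
apply: (@le_trans _ _ (alpha R M)).
  by apply: correlation_ratio_le_alpha hb1 _ _ hb2 _ _; rewrite ?ib1 ?jb1 ?ib2 ?jb2.
by apply: ereal_sup_ubound; exists _, M; split => //; exact: linear_matroid_representable.
Qed.

End PencilCorrelation.

Lemma alpha_field_ge (R : realType) (F : fieldType) :
  ((8 / 7 : R)%:E <= alpha_field R F)%E.
Proof.
have [[p charp]|nochar] := pselect (exists p, p \in [pchar F]).
  have p_gt1 : (1 < p)%N by apply: prime_gt1; exact: pcharf_prime charp.
  have inj : forall s t : 'I_p, s%:R = t%:R :> F -> s = t.
    apply: natr_ord_inj => m /andP[m0 mp]; rewrite -(dvdn_pcharf charp).
    by apply/negP => /(dvdn_leq m0); rewrite leqNgt mp.
  apply: le_trans (pencil_ratio_le_alpha_field R p_gt1 inj); rewrite lee_fin.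
  have tr := transversal_bases_pchar p_gt1 inj charp.
  apply: le_trans (pencil_ratio R (T := (p ^ 4 - p ^ 3)%N) _); last first.
    by rewrite leq_subRL ?leq_exp2l // addnC.
  have p1 : 1 < p%:R :> R by rewrite (ltr_nat R 1).
  have p0 : 0 < p%:R :> R by rewrite (lt_trans ltr01).
  (* Since [T = (p - 1) p^3], the denominator is [7 (p - 1) p^3] and the ratio is exactly 8/7. *)
  rewrite natrB ?leq_exp2l // !natrX le_eqVlt; apply/orP; left; apply/eqP.
  field; rewrite (_ : _ + _ = 7 * (p%:R - 1) * p%:R ^+ 3); last by ring.
  by rewrite lt0r_neq0 // !(mulr_gt0, exprn_gt0) // subr_gt0.
have char0 : [pchar F] =i pred0.
  by move=> p; apply/negP => charp; apply: nochar; exists p.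
have inj N : forall s t : 'I_N, s%:R = t%:R :> F -> s = t.
  apply: natr_ord_inj => m /andP[m0 _].
  by move/pcharf0P: char0 => ->; rewrite -lt0n.
apply/lee_addgt0Pr => e e0.
(* The bound [8 (n - 1) / (7 n - 6)] falls short of 8/7 by [8 / (7 (7 n - 6))], which is below [e]
   once [e (n - 1) > 1]. *)
pose N := (Num.truncn e^-1).+2.
have N_gt1 : (1 < N)%N by [].
have ratio := pencil_ratio R (transversal_bases_le N_gt1 (@inj N)).
apply: le_trans (leeD (pencil_ratio_le_alpha_field R N_gt1 (@inj N)) (lexx _)).
rewrite -EFinD lee_fin -lerBlDr; apply: le_trans ratio.
have eN : e^-1 < N%:R - 1.
  by rewrite /N -natr1 addrK; exact: truncnS_gt.
have n1 : 1 < N%:R :> R by rewrite (ltr_nat R 1).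
rewrite natrX; move: (N%:R : R) n1 eN => n n1 eN.
have n0 : 0 < n by rewrite (lt_trans ltr01).
have q0 : 0 < n - 1 by rewrite subr_gt0.
have en : 1 < e * (n - 1) by rewrite -ltr_pdivrMl // mulr1.
have -> : 8 * (n - 1) * n ^+ 3 / (n ^+ 4 + 6 * (n - 1) * n ^+ 3) =
    8 * (n - 1) / (7 * n - 6).
  have d0 : 7 * n - 6 != 0 by rewrite lt0r_neq0 //; lra.
  have -> : n ^+ 4 + 6 * (n - 1) * n ^+ 3 = (7 * n - 6) * n ^+ 3 by ring.
  by field; rewrite d0 lt0r_neq0.
by rewrite ler_pdivlMr; lra.
Qed.

Theorem theorem1p7 (R : realType) (F : fieldType) :
  [/\ ((8 / 7 : R)%:E <= alpha_field R F)%E,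
      (alpha_field R F <= alpha_Mat R)%E
    & (alpha_Mat R <= (2 : R)%:E)%E].
Proof.
split; first exact: alpha_field_ge.
  by apply: le_ereal_sup => _ [E [M [_ ->]]]; exists E, M.
by apply: ub_ereal_sup => _ [E [M ->]]; exact: alpha_le2.
Qed.
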